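(* Let $\mathbb G$ be a ribbon graph with no bridges or trivial loops in which every edge has a local orientation and is directed. Let $\{\mathbb H_e:e\in E(\mathbb G)\}$ be a family of pairwise disjoint ribbon graphs such that, for each edge $e$ of $\mathbb G$, the ribbon graphs $\mathbb G$ and $\mathbb H_e$ have the edge $e$ in common but are otherwise disjoint, and $e$ has a local orientation and is directed in $\mathbb H_e$. Let $\mathbb H$ be a ribbon graph with a distinguished edge $a$ that is neither a bridge nor a trivial loop and that has a local orientation and is directed, and suppose that for each edge $e$ of $\mathbb G$ there is an isomorphism $\phi_e:\mathbb H_e\to\mathbb H$ with $\phi_e(e)=a$, preserving the local orientation and the direction of $e$. Let $\Phi=\{\phi_e:e\in E(\mathbb G)\}$ and $E'=E(\mathbb H)-\{a\}$. Then \[ Q(\mathbb G\otimes_\Phi\mathbb H;(\boldsymbol u,\boldsymbol v,\boldsymbol w),t)=t^{e(\mathbb G)(k(\mathbb H)-1)}\,Q\big(\mathbb G;\{u_e=\phi_e^{-1}(\dot y),\ v_e=\phi_e^{-1}(\overline y),\ w_e=\phi_e^{-1}(\widehat y)\}_{e\in E(\mathbb G)},t\big),\] where $(\dot y,\overline y,\widehat y)$ is the unique solution to the following system of linear equations in the ring $\mathbb Z[t,\{u_e,v_e,w_e\}_{e\in E'}]$: \begin{align*} Q(\mathbb H/a;(\boldsymbol u,\boldsymbol v,\boldsymbol w),t)&=t^{k(\mathbb H)}(t\dot y+\overline y+\widehat y),\\ Q(\mathbb H\backslash a;(\boldsymbol u,\boldsymbol v,\boldsymbol w),t)&=t^{k(\mathbb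 H)}(\dot y+t\overline y+\widehat y),\\ Q(\mathbb H^{\tau(a)}/a;(\boldsymbol u,\boldsymbol v,\boldsymbol w),t)&=t^{k(\mathbb H)}(\dot y+\overline y+t\widehat y). \end{align*}
   Context: A ribbon graph $\mathbb G=(V,E)$ is a surface with boundary represented as the union of two sets of discs, vertices $V$ and edges $E$, such that vertices and edges intersect in disjoint line segments, each such segment lies on the boundary of precisely one vertex and precisely one edge, and every edge contains exactly two such segments. Isomorphisms are homeomorphisms sending vertices to vertices and edges to edges (orientation preserving when the ribbon graphs are orientable). $b(\mathbb G)$, $k(\mathbb G)$, $e(\mathbb G)$, $E(\mathbb G)$ denote the number of boundary components, number of connected components, number of edges, and the edge set. $\mathbb G\backslash e$ is $\mathbb G$ with $e$ deleted ($\mathbb G\backslash A$: delete all edges in $A$). Contraction $\mathbb G/e$: if $u,v$ (possibly equal) are the vertices incident to $e$, attach a disc (a new vertex) along each boundary component of $e\cup u\cup v$, viewed as curves on $\mathbb G$, and then remove $e,u,v$. Partial Petrial $\mathbb G^{\tau(e)}$: detach one end of $e$ from its incident vertex, give the edge a half-twist, and reattach it (i.e. identify the attaching arcs with the opposite direction); $\mathbb G^{\tau(A)}$ does this for each $e\in A$. Edge sets are identified. An edge $e$ is a bridge if $k(\mathbb G\backslash e)>k(\mathbb G)$; a loop if it is incident to exactly one vertex. A loop $e$ is interlaced with a cycle $C$ if, travelling around the boundary of the vertex incident to $e$, edges are met in cyclic order $e\,c_1\,e\,c_2$ with $c_1,c_2$ edges of $C$. A loop is trivial if it is not interlaced with any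 cycle. An arrow presentation consists of a set of circles and a set of labels (edges), with for each label exactly two arrows with that label lying along the circles, all arrows disjoint. A ribbon graph gives an arrow presentation: orient the boundary of each edge $e$ arbitrarily, place an $e$-labelled arrow on each of the two arcs where $e$ meets a vertex, in the direction of the boundary orientation, and take the boundary circles of the vertices with these arrows. Conversely, an arrow presentation gives a ribbon graph by filling each circle with a vertex disc and, for each label $e$, attaching a disc with oriented boundary by identifying two disjoint arcs of its boundary with the two $e$-labelled arrows, respecting directions. Two-sum: let $\mathbb G,\mathbb H$ be ribbon graphs with exactly one edge $a$ in common, otherwise disjoint, and suppose in each of them $a$ has a local orientation (a choice of clockwise for that edge) and is directed (has a head end and a tail end). Convert both to arrow presentations, the $a$-labelled arrows following the local orientation of $a$; in each, distinguish the $a$-labelled arrow coming from the head end of $a$. Add arcs joining: the tail of the distinguished $a$-arrow of $\mathbb G$ to the head of the distinguished $a$-arrow of $\mathbb H$; the head of the distinguished $a$-arrow of $\mathbb G$ to the tail of the distinguished $a$-arrow of $\mathbb H$; and likewise tail to head and head to tail for the non-distinguished $a$-arrows. Then delete the four $a$-arrows together with the arcs of the circles they lie on. The ribbon graph of the resulting arrow presentation is $\mathbb G\oplus_2\mathbb H$. Tensor product: with $\mathbb G,\mathbb H_e,\mathbb H,\Phi$ as in the claim, $\mathbb G\otimes_\Phi\mathbb H$ is obtained by successively forming the two-sum of $\mathbb G$ with each $\mathbb H_e$ along $e$, $e\in E(\mathbb G)$. Its edge set is $\bigcup_{e\in E(\mathbb G)}(E(\mathbb H_e)-\{e\})$. Topological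 transition polynomial: with indeterminates $\boldsymbol u=\{u_e\}_{e\in E}$, $\boldsymbol v=\{v_e\}_{e\in E}$, $\boldsymbol w=\{w_e\}_{e\in E}$, $t$, \[Q(\mathbb G;(\boldsymbol u,\boldsymbol v,\boldsymbol w),t)=\sum_{(\Lambda,M,N)}\Big(\prod_{e\in\Lambda}u_e\Big)\Big(\prod_{e\in M}v_e\Big)\Big(\prod_{e\in N}w_e\Big)t^{b(\mathbb G^{\tau(N)}\backslash M)},\] summed over ordered partitions $(\Lambda,M,N)$ of $E$ into three possibly empty blocks. Writing $u_e=\ldots$ inside $Q$ means substitution for that variable. $\phi_e$ also denotes the induced ring isomorphism $\mathbb Z[t,\{u_f,v_f,w_f\}_{f\in E(\mathbb H_e)}]\to\mathbb Z[t,\{u_f,v_f,w_f\}_{f\in E(\mathbb H)}]$ with $u_f\mapsto u_{\phi_e(f)}$, $v_f\mapsto v_{\phi_e(f)}$, $w_f\mapsto w_{\phi_e(f)}$, $t\mapsto t$. *)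

(* Defs.v *)
From mathcomp Require Import all_boot all_algebra.
From mathcomp Require Import zify mpoly.

Set Implicit Arguments.
Unset Strict Implicit.
Unset Printing Implicit Defensive.

(** A ribbon graph is encoded by the finite set of its corners, called flags: a
flag is an end point of one of the line segments in which an edge disc meets a
vertex disc, i.e. the tail or the head of an arrow of an arrow presentation.
From a flag one can move along three curves, each of which leads to exactly one
other flag:
 - [seg]: the line segment shared by the edge disc and the vertex disc;
 - [side]: the part of the boundary of the edge disc, on the boundary of the
   surface, that leads to the other end of the edge;
 - [varc]: the part of the boundary of the vertex disc, on the boundary of the
   surface, that leads to the next segment (or to the other end of the same one).
The boundary of an edge disc is a 4-cycle alternating [seg] and [side], the
boundary of a vertex disc alternates [seg] and [varc], and a boundary component
of the surface alternates [side] and [varc].  Vertices meeting no edge have no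
flag; [nb_free] is their number.  [lab] names the edges by elements of [L]. *)
Record ribbon (L : finType) : Type := Ribbon {
  flag : finType;
  seg : flag -> flag;
  side : flag -> flag;
  varc : flag -> flag;
  nb_free : nat;
  lab : flag -> L;
  segK : involutive seg;
  sideK : involutive side;
  arcK : involutive varc;
  seg_neq : forall x, seg x != x;
  side_neq : forall x, side x != x;
  arc_neq : forall x, varc x != x;
  seg_side : forall x, seg (side x) = side (seg x);
  seg_neq_side : forall x, seg x != side x;
  lab_seg : forall x, lab (seg x) = lab x;
  lab_side : forall x, lab (side x) = lab x
}.

Section Basics.
Variables (L : finType) (G : ribbon L).

Definition edge_flags (x : flag G) : seq (flag G) :=
  [:: x; seg x; side x; seg (side x)].

(** Distinct edges have distinct names, so that the edge set is [edges G]. *)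
Definition proper_labels : Prop :=
  forall x y : flag G, lab x = lab y -> y \in edge_flags x.

Definition edges : {set L} := [set lab x | x : flag G].

Definition boundary_rel : rel (flag G) :=
  [rel x y | (y == side x) || (y == varc x)].
Definition vertex_rel : rel (flag G) :=
  [rel x y | (y == seg x) || (y == varc x)].
Definition graph_rel : rel (flag G) :=
  [rel x y | [|| y == seg x, y == side x | y == varc x]].

Definition nb_boundary : nat := (n_comp boundary_rel predT + nb_free G)%N.
Definition nb_comp : nat := (n_comp graph_rel predT + nb_free G)%N.

Definition same_vertex (x y : flag G) : bool := connect vertex_rel x y.

Definition loop (e : L) : Prop :=
  e \in edges /\ forall x y : flag G, lab x = e -> lab y = e -> same_vertex x y.

(** A cycle of the underlying graph, as the list of the flags at which its edges
are entered: after traversing the edge of [x] one is at the vertex of [side x].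
No vertex and no edge is repeated; a loop is a cycle of length one. *)
Definition is_cycle (c : seq (flag G)) : Prop :=
  [/\ c != [::],
      cycle (fun x y => same_vertex (side x) y) c,
      pairwise (fun x y => ~~ same_vertex x y) c &
      uniq [seq lab x | x <- c]].

(** One step of the travel around a vertex: if [x] is the first corner of a
segment, [turn x] is the first corner of the next one.  The orbit of [x] meets
every segment of the vertex exactly once, in cyclic order. *)
Definition turn (x : flag G) : flag G := varc (seg x).

Definition interlaced (e : L) (c : seq (flag G)) : Prop :=
  exists (x : flag G) (i1 i2 i3 : nat),
    [/\ lab x = e,
        (0 < i1 < i2)%N && (i2 < i3 < order turn x)%N,
        lab (iter i1 turn x) \in [seq lab z | z <- c],
        lab (iter i2 turn x) = e &
        lab (iter i3 turn x) \in [seq lab z | z <- c]].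

Definition trivial_loop (e : L) : Prop :=
  loop e /\ forall c, is_cycle c -> ~ interlaced e c.

Lemma edge_flags_uniq (x : flag G) : uniq (edge_flags x).
Proof.
rewrite /edge_flags /= !inE !negb_or andbT.
have h1 : x != seg x by rewrite eq_sym seg_neq.
have h2 : x != side x by rewrite eq_sym side_neq.
have h3 : x != seg (side x).
  by apply/eqP => h; have := seg_neq_side x; rewrite {1}h segK eqxx.
have h4 : seg x != seg (side x) by rewrite (inj_eq (can_inj (@segK _ G))).
by rewrite h1 h2 h3 h4 seg_neq_side eq_sym seg_neq.
Qed.

Lemma edge_flags_seg (x z : flag G) :
  (seg z \in edge_flags x) = (z \in edge_flags x).
Proof.
rewrite /edge_flags !inE (inj_eq (can_inj (@segK _ G))).
rewrite !(can2_eq (@segK _ G) (@segK _ G)) segK.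
by case: (z == x); case: (z == seg x); case: (z == side x);
   case: (z == seg (side x)).
Qed.

Lemma edge_flags_side (x z : flag G) :
  (side z \in edge_flags x) = (z \in edge_flags x).
Proof.
rewrite /edge_flags !inE (inj_eq (can_inj (@sideK _ G))).
rewrite !(can2_eq (@sideK _ G) (@sideK _ G)) seg_side sideK.
by case: (z == x); case: (z == seg x); case: (z == side x);
   case: (z == side (seg x)).
Qed.

End Basics.

(** Given an involution [j] of the flags, suppress the flags moved by [j], together
with their segments, and let the vertex boundary, when it reaches such a flag
[x], continue from [j x].  The remaining flags are joined by arcs that alternate
[varc] and [j]; the closed curves made of suppressed flags only become boundaries
of vertices meeting no edge. *)
Section Reroute.
Variables (L : finType) (G : ribbon L) (j : flag G -> flag G).
Hypothesis jK : involutive j.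
Hypothesis j_seg : forall x, (j (seg x) == seg x) = (j x == x).
Hypothesis j_side : forall x, (j (side x) == side x) = (j x == x).

Definition kept : finType := {x : flag G | j x == x}.
Definition step (x : flag G) : flag G := varc (j x).

Lemma step_inj : injective step.
Proof. exact: inj_comp (can_inj (@arcK _ G)) (can_inj jK). Qed.

Lemma step_return (x : kept) :
  exists n, j (iter n.+1 step (val x)) == iter n.+1 step (val x).
Proof.
exists (order step (val x)).-1.
by rewrite prednK ?order_gt0 // iter_order ?(valP x) //; apply: step_inj.
Qed.

Lemma j_step_rev n (x : flag G) : iter n step (j (iter n step x)) = j x.
Proof.
elim: n x => // n IHn x; rewrite iterSr [in X in j X]iterS /step jK.
by rewrite arcK -/(step _) IHn.
Qed.

Definition return_time (x : kept) : nat := ex_minn (step_return x).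

Lemma return_timeP (x : kept) :
  j (iter (return_time x).+1 step (val x)) ==
  iter (return_time x).+1 step (val x).
Proof. by rewrite /return_time; case: ex_minnP. Qed.

Lemma return_time_min (x : kept) n :
  j (iter n.+1 step (val x)) == iter n.+1 step (val x) -> (return_time x <= n)%N.
Proof. by rewrite /return_time; case: ex_minnP => m _; apply. Qed.

Definition reroute_arc (x : kept) : kept :=
  exist _ (iter (return_time x).+1 step (val x)) (return_timeP x).

Lemma step_rev (x : kept) m :
  (m <= (return_time x).+1)%N ->
  iter m step (val (reroute_arc x)) = j (iter ((return_time x).+1 - m) step (val x)).
Proof.
move=> le_m; set n := (return_time x).+1 in le_m *.
rewrite -[LHS](congr1 (iter m step) (eqP (return_timeP x))) -/n.
by rewrite -{1}(subnKC le_m) iterD j_step_rev.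
Qed.

Lemma return_time_rev (x : kept) : return_time (reroute_arc x) = return_time x.
Proof.
have fixJ y : (j (j y) == j y) = (j y == y) by rewrite jK eq_sym.
apply/eqP; rewrite eqn_leq; apply/andP; split.
  apply: return_time_min; rewrite step_rev // subnn /= fixJ.
  exact: valP x.
rewrite leqNgt; apply/negP => lt.
have := return_timeP (reroute_arc x); rewrite step_rev ?fixJ; last exact: ltnW.
set n := return_time x in lt *; set m := return_time _ in lt *.
rewrite subSS -(subnSK lt) => /return_time_min.
by rewrite -/n leqNgt subnSK // => /negP; apply; lia.
Qed.

Lemma reroute_arcK : involutive reroute_arc.
Proof.
move=> x; apply: val_inj.
rewrite -[LHS]/(iter (return_time (reroute_arc x)).+1 step (val (reroute_arc x))).
by rewrite return_time_rev step_rev // subnn; apply/eqP/(valP x).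
Qed.

Lemma reroute_arc_neq x : reroute_arc x != x.
Proof.
apply/eqP => ex; set n := (return_time x).+1.
have rev m : (m <= n)%N -> iter m step (val x) = j (iter (n - m) step (val x)).
  by move=> le_m; rewrite -step_rev // ex.
have := odd_double_half n; case: odd => /= def_n.
  have := rev n./2.+1; rewrite (_ : n - n./2.+1 = n./2)%N; last lia.
  by move=> /(_ ltac:(lia)) /=; rewrite /step => /eqP; rewrite (negPf (arc_neq _)).
have lt : (n./2.-1 < (return_time x))%N by rewrite -/n in def_n *; lia.
have := rev n./2; rewrite (_ : n - n./2 = n./2)%N; last lia.
move=> /(_ ltac:(lia)) /esym/eqP.
rewrite -{1 2}(_ : n./2.-1.+1 = n./2)%N; last by lia.
by move=> /return_time_min; rewrite leqNgt lt.
Qed.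

Definition reroute_seg (x : kept) : kept :=
  exist _ (seg (val x)) (etrans (j_seg (val x)) (valP x)).
Definition reroute_side (x : kept) : kept :=
  exist _ (side (val x)) (etrans (j_side (val x)) (valP x)).

Definition reroute_rel : rel (flag G) := [rel x y | (y == j x) || (y == varc x)].

Definition reroute_free : nat :=
  (nb_free G +
   n_comp reroute_rel
     [pred x | [forall y, connect reroute_rel x y ==> (j y != y)]])%N.

Definition reroute : ribbon L.
refine (@Ribbon L kept reroute_seg reroute_side reroute_arc reroute_free
          (fun x => lab (val x)) _ _ reroute_arcK _ _ reroute_arc_neq _ _ _ _).
- by move=> x; apply: val_inj; rewrite /= segK.
- by move=> x; apply: val_inj; rewrite /= sideK.
- by move=> x; rewrite -val_eqE /= seg_neq.
- by move=> x; rewrite -val_eqE /= side_neq.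
- by move=> x; apply: val_inj; rewrite /= seg_side.
- by move=> x; rewrite -val_eqE /= seg_neq_side.
- by move=> x; rewrite /= lab_seg.
- by move=> x; rewrite /= lab_side.
Defined.
End Reroute.

Section Operations.
Variables (L : finType) (G : ribbon L).
Implicit Type A : {set L}.

Section OnEdges.
Variables (A : {set L}) (f : flag G -> flag G).
Hypotheses (fK : involutive f) (f_neq : forall x, f x != x).
Hypotheses (f_seg : forall x, f (seg x) = seg (f x)).
Hypotheses (f_side : forall x, f (side x) = side (f x)).
Hypothesis lab_f : forall x, lab (f x) = lab x.

Definition on_edges (x : flag G) : flag G := if lab x \in A then f x else x.

Lemma on_edgesK : involutive on_edges.
Proof.
move=> x; rewrite /on_edges.
by case: (boolP (lab x \in A)) => h; rewrite ?lab_f ?h ?(negPf h) ?fK.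
Qed.

Lemma on_edges_seg x : (on_edges (seg x) == seg x) = (on_edges x == x).
Proof.
rewrite /on_edges lab_seg; case: ifP => _; last by rewrite !eqxx.
by rewrite f_seg (inj_eq (can_inj (@segK _ G))).
Qed.

Lemma on_edges_side x : (on_edges (side x) == side x) = (on_edges x == x).
Proof.
rewrite /on_edges lab_side; case: ifP => _; last by rewrite !eqxx.
by rewrite f_side (inj_eq (can_inj (@sideK _ G))).
Qed.
End OnEdges.

(** When the edges in [A] are removed, the vertex boundary runs through the
segments they occupied. *)
Definition delete A : ribbon L :=
  reroute (on_edgesK A (@segK _ G) (@lab_seg _ G))
    (on_edges_seg A (fun=> erefl)) (on_edges_side A (@seg_side _ G)).

(** The boundary components of [e] together with its incident vertices run along
the sides of [e]; they bound the new vertices. *)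
Definition contract (e : L) : ribbon L :=
  reroute (on_edgesK [set e] (@sideK _ G) (@lab_side _ G))
    (on_edges_seg [set e] (fun x => esym (seg_side x)))
    (on_edges_side [set e] (fun=> erefl)).

(** Reversing the attaching direction at one end of an edge exchanges, for each
corner of the edge, the two corners at the other end. *)
Definition petrial_side A (x : flag G) : flag G :=
  if lab x \in A then seg (side x) else side x.

Definition petrial A : ribbon L.
refine (@Ribbon L (flag G) (@seg L G) (petrial_side A) (@varc L G) (nb_free G)
          (@lab L G) (@segK _ G) _ (@arcK _ G) (@seg_neq _ G) _ (@arc_neq _ G)
          _ _ (@lab_seg _ G) _).
- move=> x; rewrite /petrial_side.
  case: (boolP (lab x \in A)) => h; rewrite ?lab_seg lab_side.
    by rewrite h -seg_side segK sideK.
  by rewrite (negPf h) sideK.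
- move=> x; rewrite /petrial_side; case: ifP => _; last exact: side_neq.
  by apply/eqP => h; have := seg_neq_side x; rewrite -{1}h segK eqxx.
- by move=> x; rewrite /petrial_side lab_seg; case: ifP; rewrite seg_side.
- move=> x; rewrite /petrial_side; case: ifP => _; last exact: seg_neq_side.
  by rewrite (inj_eq (can_inj (@segK _ G))) eq_sym side_neq.
- by move=> x; rewrite /petrial_side; case: ifP; rewrite ?lab_seg lab_side.
Defined.

Definition bridge (e : L) : Prop := (nb_comp G < nb_comp (delete [set e]))%N.

End Operations.


Definition disjoint_union (L : finType) (G H : ribbon L) : ribbon L.
pose lift (f : flag G -> flag G) (g : flag H -> flag H) z :=
  match z with inl x => inl (f x) | inr y => inr (g y) end.
refine (@Ribbon L (flag G + flag H)%type
          (lift (@seg _ G) (@seg _ H)) (lift (@side _ G) (@side _ H))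
          (lift (@varc _ G) (@varc _ H)) (nb_free G + nb_free H)%N
          (fun z => match z with inl x => lab x | inr y => lab y end)
          _ _ _ _ _ _ _ _ _ _).
- by move=> [] x; rewrite /= segK.
- by move=> [] x; rewrite /= sideK.
- by move=> [] x; rewrite /= arcK.
- by move=> [] x; exact: (seg_neq x).
- by move=> [] x; exact: (side_neq x).
- by move=> [] x; exact: (arc_neq x).
- by move=> [] x; rewrite /= seg_side.
- by move=> [] x; exact: (seg_neq_side x).
- by move=> [] x; rewrite /= lab_seg.
- by move=> [] x; rewrite /= lab_side.
Defined.

(** A local orientation and a direction of an edge amount to the choice of one of
its four corners, namely the tail of the arrow at the head end of the edge, where
arrows follow the local orientation.  If [x] is this corner, then the boundary of
the edge, in the direction of the local orientation, runs through
 - [x], [seg x]: tail and head of the arrow at the head end,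
 - [side (seg x)], [side x]: tail and head of the arrow at the tail end. *)
Section TwoSum.
Variables (L : finType) (G H : ribbon L) (x : flag G) (y : flag H).

(** Joins tails of the arrows of [G] to heads of the corresponding arrows of [H],
and heads to tails. *)
Definition two_sum_join (z : flag (disjoint_union G H)) :
    flag (disjoint_union G H) :=
  match z with
  | inl z' => if z' == x then inr (seg y)
              else if z' == seg x then inr y
              else if z' == side (seg x) then inr (side y)
              else if z' == side x then inr (side (seg y))
              else z
  | inr z' => if z' == seg y then inl x
              else if z' == y then inl (seg x)
              else if z' == side y then inl (side (seg x))
              else if z' == side (seg y) then inl (side x)
              else z
  end.

Lemma two_sum_joinK : involutive two_sum_join.
Proof.
have E (K : ribbon L) (u : flag K) :
    [/\ (u == seg u) = false, (u == side u) = false,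
       (u == side (seg u)) = false, (seg u == side u) = false &
       [/\ (seg u == side (seg u)) = false & (side u == side (seg u)) = false]].
  have := edge_flags_uniq u; rewrite /edge_flags /= !inE !negb_or andbT seg_side.
  by case/and3P=> /and3P[/negPf h1 /negPf h2 /negPf h3] /andP[/negPf h4 /negPf h5]
       /negPf h6.
have [x1 x2 x3 x4 [x5 x6]] := E G x; have [y1 y2 y3 y4 [y5 y6]] := E H y.
have xs := (x1, x2, x3, x4, (x5, x6)); have ys := (y1, y2, y3, y4, (y5, y6)).
move=> [] z; rewrite /two_sum_join.
  case: (eqVneq z x) => [->|zx]; first by rewrite eqxx.
  case: (eqVneq z (seg x)) => [->|zx1]; first by rewrite ys eqxx.
  case: (eqVneq z (side (seg x))) => [->|zx2].
    by rewrite !(eq_sym (side y)) !ys eq_sym ys eqxx.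
  case: (eqVneq z (side x)) => [->|zx3].
    by rewrite !(eq_sym (side (seg y))) !ys eqxx.
  by rewrite (negPf zx) (negPf zx1) (negPf zx2) (negPf zx3).
case: (eqVneq z (seg y)) => [->|zy]; first by rewrite eqxx.
case: (eqVneq z y) => [->|zy1]; first by rewrite eq_sym xs eqxx.
case: (eqVneq z (side y)) => [->|zy2].
  by rewrite !(eq_sym (side (seg x))) !xs eqxx.
case: (eqVneq z (side (seg y))) => [->|zy3].
  by rewrite (eq_sym _ x) (eq_sym _ (seg x)) !xs eqxx.
by rewrite (negPf zy) (negPf zy1) (negPf zy2) (negPf zy3).
Qed.

Lemma two_sum_join_fix z :
  (two_sum_join z == z) =
  match z with
  | inl z' => z' \notin edge_flags x
  | inr z' => z' \notin edge_flags y
  end.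
Proof.
rewrite /two_sum_join /edge_flags; case: z => z; rewrite !inE !negb_or !seg_side.
  case: (z == x) => //; case: (z == seg x) => //.
  by case: (z == side (seg x)); case: (z == side x); rewrite ?eqxx.
case: (z == seg y); case: (z == y) => //.
by case: (z == side y); case: (z == side (seg y)); rewrite ?eqxx.
Qed.

Lemma two_sum_join_seg z :
  (two_sum_join (seg z) == seg z) = (two_sum_join z == z).
Proof. by rewrite !two_sum_join_fix; case: z => z /=; rewrite edge_flags_seg. Qed.

Lemma two_sum_join_side z :
  (two_sum_join (side z) == side z) = (two_sum_join z == z).
Proof. by rewrite !two_sum_join_fix; case: z => z /=; rewrite edge_flags_side. Qed.

Definition two_sum : ribbon L :=
  reroute two_sum_joinK two_sum_join_seg two_sum_join_side.

(** The flag of the two-sum given by a flag of [G], if it is not on the edge of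
[x]. *)
Definition two_sum_inl (z : flag G) : option (flag two_sum) := insub (inl z).

End TwoSum.

(** [s] lists one corner of each edge of [G], i.e. the local orientations and the
directions, in the order in which the two-sums are formed; [o e] does the same
for the edge [e] of [Hs e].  [emb] keeps track of the flags of [G] that still
belong to the intermediate ribbon graph [K]. *)
Section Tensor.
Variables (L : finType) (G : ribbon L) (Hs : L -> ribbon L).
Variable o : forall e, flag (Hs e).

Fixpoint tensor_rec (K : ribbon L) (emb : flag G -> option (flag K))
    (s : seq (flag G)) : ribbon L :=
  match s with
  | [::] => K
  | x :: s' =>
      match emb x with
      | Some x' =>
          tensor_rec (fun z => obind (two_sum_inl x' (o (lab x))) (emb z)) s'
      | None => tensor_rec emb s'
      end
  end.

Definition tensor (s : seq (flag G)) : ribbon L := tensor_rec (@Some _) s.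
End Tensor.

Section Isomorphism.
Variables (L : finType) (G H : ribbon L).

(** Names of edges need not be preserved. *)
Definition is_iso (f : flag G -> flag H) : Prop :=
  [/\ bijective f,
      {morph f : x / seg x >-> seg x},
      {morph f : x / side x >-> side x},
      {morph f : x / varc x >-> varc x} &
      nb_free G = nb_free H].

(** The edge of [G] sent by [f] to the edge [l] of [H]; [l] itself if there is
none. *)
Definition edge_inv (f : flag G -> flag H) (l : L) : L :=
  if [pick x | lab (f x) == l] is Some x then lab x else l.
End Isomorphism.

Import GRing.Theory.
Local Open Scope ring_scope.

Definition ordered_partition (L : finType) (E : {set L})
    (P : {set L} * {set L} * {set L}) : bool :=
  let: (A, B, C) := P in
  [&& A :|: B :|: C == E, [disjoint A & B], [disjoint A & C] & [disjoint B & C]].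

(** [Q G u v w t] is the value of the polynomial under a substitution. *)
Definition Q (L : finType) (R : comNzRingType) (G : ribbon L) (u v w : L -> R)
    (t : R) : R :=
  \sum_(P : {set L} * {set L} * {set L} | ordered_partition (edges G) P)
    let: (A, M, N) := P in
    (\prod_(e in A) u e) * (\prod_(e in M) v e) * (\prod_(e in N) w e)
    * t ^+ nb_boundary (delete (petrial G N) M).

(** [None] stands for t and [Some (e, i)] for u_e, v_e, w_e when i = 0, 1, 2.
The ring Z[t, {u_e, v_e, w_e : e in A}] is the subring [in_vars A] of [polyZ L]. *)
Definition var (L : finType) : finType := option (L * 'I_3)%type.
Definition polyZ (L : finType) : comNzRingType := {mpoly int[#|var L|]}.

Section Polynomials.
Variable L : finType.

Definition indet (i : var L) : polyZ L := 'X_(enum_rank i).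
Definition varT : polyZ L := indet None.
Definition varU (e : L) : polyZ L := indet (Some (e, inord 0)).
Definition varV (e : L) : polyZ L := indet (Some (e, inord 1)).
Definition varW (e : L) : polyZ L := indet (Some (e, inord 2)).

Definition in_vars (A : {set L}) (p : polyZ L) : Prop :=
  forall (m : 'X_{1..#|var L|}) (e : L) (i : 'I_3),
    m \in msupp p -> m (enum_rank (Some (e, i))) != 0%N -> e \in A.

Definition relabel_var (s : L -> L) (i : var L) : var L :=
  omap (fun ei => (s ei.1, ei.2)) i.

(** The substitution u_e, v_e, w_e |-> u_(s e), v_(s e), w_(s e). *)
Definition relabel (s : L -> L) (p : polyZ L) : polyZ L :=
  p \mPo [tuple indet (relabel_var s (enum_val i)) | i < #|var L|].
End Polynomials.

(** The linear system that determines the weights of the edges of the first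
factor, for [y = (ydot, ybar, yhat)]. *)
Definition tensor_system (L : finType) (H : ribbon L) (a : L)
    (y : polyZ L * polyZ L * polyZ L) : Prop :=
  let: (ydot, ybar, yhat) := y in
  let t := varT L in
  let Qgen K := Q K (@varU L) (@varV L) (@varW L) t in
  [/\ Qgen (contract H a) = t ^+ nb_comp H * (t * ydot + ybar + yhat),
      Qgen (delete H [set a]) = t ^+ nb_comp H * (ydot + t * ybar + yhat) &
      Qgen (contract (petrial H [set a]) a) = t ^+ nb_comp H * (ydot + ybar + t * yhat)].

(* Main.v *)
(** Resolving every edge of a ribbon graph (keeping, deleting or twisting it) joins
the corners of each edge in one of three ways, and Q is the generating function of
the number of closed curves obtained.  Resolving the edges of H other than a leaves
some closed curves together with two arcs that join the four corners of a in one of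
the same three ways.  Hence, in the tensor product, the copy of H at e acts as an
edge e of G whose weights are the generating functions of the states of H minus a,
sorted by the pairing of the corners of a.  Each component of H contributes at least
one curve to the total, so all these weights are divisible by t^(k(H) - 1); the
quotients are the solution of the linear system, whose determinant, up to a power
of t, is (t - 1)^2 (t + 2). *)

Require Import Defs.
From mathcomp Require Import all_boot all_algebra.
From mathcomp Require Import zify ring mpoly.

Set Implicit Arguments.
Unset Strict Implicit.
Unset Printing Implicit Defensive.
Import GRing.Theory.
Local Open Scope ring_scope.

(** * Closed curves after rerouting *)

(** [reroute] underlies deletion, contraction and the two-sum alike, so a single count,
    [reroute_circles], serves all three: pairing the remaining flags and following [j] on the
    suppressed ones gives the same number of closed curves, those without remaining flags
    reappearing as free vertices. The same construction produces the arcs in H: rerouting along a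
    pairing that fixes just the corners of a leaves a graph with four flags. That these arcs agree
    with one of the three resolutions, and that a two-sum transfers them from H to G, both come from
    the Klein four-group formed by the identity, [side], [seg] and their composite: it acts simply
    transitively on the corners of an edge, and the join of the two-sum commutes with it. The
    division by t^(k(H) - 1) is never performed on polynomials; the exponent of each state is
    lowered instead, thanks to a bound that holds state by state. *)

Lemma connect_ind (T : finType) (e : rel T) (P : T -> Prop) x y :
  (forall z z', P z -> e z z' -> P z') -> P x -> connect e x y -> P y.
Proof.
move=> eP Px /connectP[p + ->]; elim: p x Px => //= z p IHp x Px /andP[exz].
by apply: IHp; apply: eP exz.
Qed.

Lemma connect_map (T T' : finType) (h : T' -> T) (e : rel T) (e' : rel T') x y :
  (forall z z', e' z z' -> connect e (h z) (h z')) ->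
  connect e' x y -> connect e (h x) (h y).
Proof.
move=> ee'; apply: (connect_ind (P := fun z => connect e (h x) (h z))) => //.
by move=> z z' c /ee'; apply: connect_trans.
Qed.

(** A component of [e] either meets the image of [h1] or avoids it. The first kind is counted
    through [h1], the second through [h2] on [a2], each by adjunction of the connectivity
    relations. *)
Lemma n_comp_split (T T1 T2 : finType) (e : rel T) (e1 : rel T1) (e2 : rel T2)
    (h1 : T1 -> T) (h2 : T2 -> T) (a2 : {pred T2}) :
  connect_sym e -> connect_sym e1 -> connect_sym e2 ->
  (forall x y, connect e1 x y = connect e (h1 x) (h1 y)) ->
  (forall z, (exists x, connect e z (h1 x)) \/ (exists x, connect e z (h2 x))) ->
  (forall w, (w \in a2) = ~~ [exists x, connect e (h2 w) (h1 x)]) ->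
  (forall w w', w \in a2 -> connect e2 w w' = connect e (h2 w) (h2 w')) ->
  n_comp e predT = (n_comp e1 predT + n_comp e2 a2)%N.
Proof.
move=> sym sym1 sym2 he1 cover def_a2 he2.
pose a := [pred z | [exists x, connect e z (h1 x)]].
have cl_a : closed e a.
  move=> x y exy; apply/existsP/existsP => -[z cz]; exists z.
    by apply: connect_trans cz; rewrite sym connect1.
  exact: connect_trans (connect1 exy) cz.
have cl_aC : closed e [predC a] by move=> x y /cl_a; rewrite !inE => ->.
rewrite (n_compC a); congr (_ + _)%N.
  rewrite (adjunction_n_comp h1 sym sym1 cl_a).
    by apply: eq_n_comp_r => x; rewrite !inE; apply/existsP; exists x.
  by split=> [x /existsP/sigW|x y _]; last exact: he1.
rewrite (adjunction_n_comp h2 sym sym2 cl_aC).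
  by apply: eq_n_comp_r => x; rewrite def_a2 !inE.
split=> [x /= |x y] /=; rewrite !inE.
  move=> nx; apply: sigW; case: (cover x) => //.
  by move=> /existsP; rewrite (negPf nx).
by move=> nx; apply: he2; rewrite def_a2.
Qed.

Definition circ_rel (T : finType) (arc s : T -> T) : rel T :=
  fun x y => (y == s x) || (y == arc x).
Arguments circ_rel T arc s x y /.

Lemma circ_sym (T : finType) (arc s : T -> T) :
  involutive arc -> involutive s -> connect_sym (circ_rel arc s).
Proof.
move=> arcK sK; apply: sym_connect_sym => x y /=.
by rewrite !(eq_sym y) (can2_eq sK sK) (can2_eq arcK arcK).
Qed.

(** The number of boundary components once the edges are replaced by the pairing
[s] of their corners. *)
Definition circles (L : finType) (G : ribbon L) (s : flag G -> flag G) : nat :=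
  (n_comp (circ_rel (@varc _ G) s) predT + nb_free G)%N.

Lemma eq_circles (L : finType) (G : ribbon L) (s s' : flag G -> flag G) :
  s =1 s' -> circles s = circles s'.
Proof.
move=> ss'; congr (_ + _)%N; apply: eq_n_comp; apply: eq_connect => x y /=.
by rewrite ss'.
Qed.

Section RerouteCircles.
Variables (L : finType) (G : ribbon L) (j : flag G -> flag G).
Hypothesis jK : involutive j.
Variables (s : flag G -> flag G) (s' : kept j -> kept j).
Hypothesis sK' : involutive s'.
Hypothesis val_s : forall x, val (s' x) = s (val x).
Hypothesis moved_s : forall x, j x != x -> s x = j x.

Lemma reroute_invol : involutive s.
Proof.
move=> x; case: (eqVneq (j x) x) => jx; last first.
  by rewrite (moved_s jx) moved_s ?jK // eq_sym.
have jxb : j x == x by apply/eqP.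
by have := congr1 val (sK' (exist _ x jxb)); rewrite !val_s.
Qed.

Lemma return_time_moved (x : kept j) m :
  (0 < m <= return_time jK x)%N -> j (iter m (step j) (val x)) != iter m (step j) (val x).
Proof.
case: m => // m /andP[_ lt_m]; apply/negP => /(@return_time_min _ _ _ jK).
by rewrite leqNgt lt_m.
Qed.

(** An arc of the rerouted graph unfolds to a walk alternating [varc] and [j], whose interior flags
    are moved by [j], where [s] is [j]. Conversely, a walk can change arcs only at a kept flag,
    where [s] restricts to [s']. *)
Lemma reroute_connect (x y : kept j) :
  connect (circ_rel (reroute_arc jK) s') x y =
  connect (circ_rel (@varc _ G) s) (val x) (val y).
Proof.
apply/idP/idP.
  apply: connect_map => z z' /orP[] /eqP ->.
    by apply: connect1; rewrite /= val_s eqxx.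
  set r := return_time jK z.
  suff: forall m, (m <= r)%N ->
      connect (circ_rel (@varc _ G) s) (val z) (iter m.+1 (step j) (val z)).
    by move=> /(_ _ (leqnn _)).
  elim=> [_|m IHm lt_m].
    by apply: connect1; rewrite /= /step (eqP (valP z)) eqxx orbT.
  apply: connect_trans (IHm (ltnW lt_m)) _.
  rewrite [X in connect _ _ X]iterS; set u := iter m.+1 _ _.
  have ju : j u != u by apply: return_time_moved.
  apply: (@connect_trans _ _ (j u)); first by apply: connect1; rewrite /= moved_s ?eqxx.
  by apply: connect1; rewrite /= /step eqxx orbT.
(* [z] lies on the arc followed from some [w] connected to [x]. *)
pose P z := exists2 w : kept j, connect (circ_rel (reroute_arc jK) s') x w &
  exists2 m, (m <= return_time jK w)%N &
    z = j (iter m (step j) (val w)) \/ z = iter m.+1 (step j) (val w).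
have startP w : connect (circ_rel (reroute_arc jK) s') x w -> P (val w).
  by move=> cw; exists w => //; exists 0%N => //; left; rewrite /= (eqP (valP w)).
move=> cxy.
have : P (val y).
  apply: connect_ind (startP _ (connect0 _ _)) cxy => z z' [w cw [m le_m +]].
  have stepw w' : circ_rel (reroute_arc jK) s' w w' -> P (val w').
    by move=> ww'; apply: startP; apply: connect_trans cw (connect1 ww').
  case=> -> /orP[] /eqP ->.
  - case: m le_m => [|m] le_m.
      by rewrite /= (eqP (valP w)) -val_s; apply: stepw; rewrite /= eqxx.
    have ju := @return_time_moved w m.+1 le_m.
    rewrite moved_s; last by rewrite jK eq_sym.
    by rewrite jK; exists w => //; exists m; [apply: ltnW | right].
  - by exists w => //; exists m => //; right.
  - case: (ltngtP m (return_time jK w)) le_m => // [lt_m _|-> _].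
      rewrite moved_s; last exact: return_time_moved.
      by exists w => //; exists m.+1 => //; left.
    have cA : connect (circ_rel (reroute_arc jK) s') w (reroute_arc jK w).
      by apply: connect1; rewrite /= eqxx orbT.
    rewrite -[iter _ _ _]/(val (reroute_arc jK w)) -val_s; apply: startP.
    by apply: connect_trans cw (connect_trans cA _); apply: connect1; rewrite /= eqxx.
  - by exists w => //; exists m => //; left; rewrite iterS /step arcK.
case=> w cw [m le_m def_y]; have := valP y; rewrite /= => jy.
case: def_y => def_y; last first.
  have def_m : m = return_time jK w.
    by apply/eqP; rewrite eqn_leq le_m; apply: return_time_min; rewrite -def_y.
  have -> : y = reroute_arc jK w by apply: val_inj; rewrite [LHS]def_y def_m.
  by apply: connect_trans cw (connect1 _); rewrite /= eqxx orbT.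
case: m le_m def_y => [|m] le_m def_y.
  by move: def_y; rewrite /= (eqP (valP w)) => /val_inj ->.
have := @return_time_moved w m.+1 le_m; case/eqP.
by move: jy; rewrite def_y jK eq_sym => /eqP.
Qed.

(** The second summand counts the curves made of moved flags only: there [s] equals [j], so
    [reroute_rel] sees the same curves. It is the number of free vertices that [reroute] adds. *)
Lemma reroute_n_comp :
  n_comp (circ_rel (@varc _ G) s) predT =
  (n_comp (circ_rel (reroute_arc jK) s') predT +
   n_comp (reroute_rel j)
     [pred x | [forall y, connect (reroute_rel j) x y ==> (j y != y)]])%N.
Proof.
have sK := reroute_invol.
have sym := circ_sym (@arcK _ G) sK.
have symj : connect_sym (reroute_rel j) := circ_sym (@arcK _ G) jK.
have conn_eq x : (forall y, connect (reroute_rel j) x y -> j y != y) ->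
    connect (reroute_rel j) x =1 connect (circ_rel (@varc _ G) s) x.
  move=> mv y; pose P z := connect (circ_rel (@varc _ G) s) x z /\
    connect (reroute_rel j) x z.
  have P0 : P x by split; apply: connect0.
  apply/idP/idP => cxy.
    apply: (proj1 (connect_ind (P := P) _ P0 cxy)) => z z' [c1 c2] ezz'.
    split; last exact: connect_trans c2 (connect1 ezz').
    apply: connect_trans c1 (connect1 _); move: ezz'; rewrite /= moved_s //.
    exact: mv c2.
  apply: (proj2 (connect_ind (P := P) _ P0 cxy)) => z z' [c1 c2] ezz'.
  split; first exact: connect_trans c1 (connect1 ezz').
  apply: connect_trans (c2) (connect1 _); move: ezz'; rewrite /= moved_s //.
  exact: mv c2.
apply: (n_comp_split (h1 := val) (h2 := id)) => //.
- exact: circ_sym (reroute_arcK jK) sK'.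
- exact: reroute_connect.
- by move=> z; right; exists z; apply: connect0.
- move=> w; rewrite !inE; apply/idP/idP.
    move/forallP => mv; rewrite negb_exists; apply/forallP => x.
    rewrite -conn_eq; last by move=> y cy; apply: (implyP (mv y)).
    by apply/negP => cx; have := implyP (mv _) cx; rewrite (valP x).
  apply: contraR; rewrite negb_forall => /existsP[y]; rewrite negb_imply negbK.
  case/andP=> cwy jy; apply/existsP.
  (* A walk of [reroute_rel] that has not yet met a kept flag is also a walk for [s]. *)
  pose P z := (exists x : kept j, connect (circ_rel (@varc _ G) s) w (val x)) \/
              connect (circ_rel (@varc _ G) s) w z.
  have : P y.
    apply: connect_ind cwy; last by right; apply: connect0.
    move=> z z' [|c ezz']; first by left.
    case: (boolP (j z == z)) => jz; first by left; exists (exist _ z jz).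
    right; apply: connect_trans c (connect1 _).
    by move: ezz'; rewrite /= moved_s.
  by case=> // c; exists (exist _ y jy).
- move=> w w'; rewrite !inE => /forallP mv; apply: conn_eq => y cy.
  exact: (implyP (mv y)).
Qed.

Hypothesis j_seg : forall x, (j (seg x) == seg x) = (j x == x).
Hypothesis j_side : forall x, (j (side x) == side x) = (j x == x).

Lemma reroute_circles :
  @circles _ (reroute jK j_seg j_side) s' = circles s.
Proof. by rewrite /circles reroute_n_comp /= /reroute_free; lia. Qed.

End RerouteCircles.

(** * States *)

Section States.
Variable L : finType.
Implicit Types (G H : ribbon L) (q : 'I_3) (f : L -> 'I_3).

(** The ways to join the corners of an edge when it is kept (0), deleted (1) or
twisted (2). *)
Definition move G q (x : flag G) : flag G :=
  match nat_of_ord q with 0 => side x | 1 => seg x | _ => seg (side x) end.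

Lemma ord3P (P : 'I_3 -> Prop) :
  (forall h0 h1 h2, [/\ P (@Ordinal 3 0 h0), P (@Ordinal 3 1 h1) &
                        P (@Ordinal 3 2 h2)]) -> forall q, P q.
Proof.
move=> h [[|[|[|]]] //= lt].
- by have [] := h lt isT isT.
- by have [] := h isT lt isT.
- by have [] := h isT isT lt.
Qed.

Lemma moveK G q : involutive (@move G q).
Proof.
by move=> x; elim/ord3P: q => *; rewrite /move /= ?sideK ?segK // -seg_side segK sideK.
Qed.

Lemma move_neq G q (x : flag G) : move q x != x.
Proof.
elim/ord3P: q => *; split; rewrite /move /= ?side_neq ?seg_neq //.
by apply/eqP => h; have := seg_neq_side x; rewrite -{1}h segK eqxx.
Qed.

Lemma lab_move G q (x : flag G) : lab (move q x) = lab x.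
Proof. by elim/ord3P: q => *; split; rewrite /move /= ?lab_seg ?lab_side. Qed.

Lemma edge_flags_move G q (x z : flag G) :
  (move q z \in edge_flags x) = (z \in edge_flags x).
Proof.
by elim/ord3P: q => *; split; rewrite /move /= ?edge_flags_seg ?edge_flags_side.
Qed.

Lemma edge_flags_lab G (x z : flag G) : z \in edge_flags x -> lab z = lab x.
Proof. by rewrite !inE => /or4P[] /eqP ->; rewrite ?lab_seg ?lab_side ?lab_seg. Qed.

Lemma edge_flagsP G (x z : flag G) :
  z \in edge_flags x -> z = x \/ exists q, z = move q x.
Proof.
rewrite !inE => /or4P[] /eqP ->; first by left.
- by right; exists (@Ordinal 3 1 isT).
- by right; exists (@Ordinal 3 0 isT).
- by right; exists (@Ordinal 3 2 isT).
Qed.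

Lemma edge_flags_refl G (x : flag G) : x \in edge_flags x.
Proof. by rewrite inE eqxx. Qed.

Lemma edge_flags_sym G (x z : flag G) :
  z \in edge_flags x -> x \in edge_flags z.
Proof.
case/edge_flagsP => [->|[q ->]]; first exact: edge_flags_refl.
by rewrite -(edge_flags_move q) edge_flags_refl.
Qed.

Lemma edge_flags_trans G (x z w : flag G) :
  z \in edge_flags x -> w \in edge_flags x -> w \in edge_flags z.
Proof.
move=> xz /edge_flagsP[->|[q ->]]; first exact: edge_flags_sym.
by rewrite edge_flags_move edge_flags_sym.
Qed.

Lemma move_inj_label G p q (x : flag G) : move p x = move q x -> p = q.
Proof.
have := edge_flags_uniq x; rewrite /= !inE !negb_or andbT.
case/and3P=> /and3P[h1 h2 h3] /andP[h4 h5] h6.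
elim/ord3P: p => ???; split; elim/ord3P: q => ???; split; rewrite /move //= => /eqP;
  rewrite ?(negPf h4) ?(negPf h5) ?(negPf h6) 1?eq_sym
          ?(negPf h4) ?(negPf h5) ?(negPf h6) // => _; exact: val_inj.
Qed.

(** With the identity, the three moves form a Klein four-group: the product of two distinct ones is
    the third. *)
Lemma move_third G p q r (x : flag G) :
  p != q -> q != r -> p != r -> move p (move q x) = move r x.
Proof.
elim/ord3P: p => ???; split; elim/ord3P: q => ???; split;
  elim/ord3P: r => ???; split => //= _ _ _;
  by rewrite /move /= ?seg_side ?sideK ?segK ?seg_side ?sideK ?segK.
Qed.

Definition st f G (x : flag G) : flag G := move (f (lab x)) x.
Arguments st f {G} x.

Lemma stK f G : involutive (@st f G).
Proof. by move=> x; rewrite /st lab_move moveK. Qed.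

Lemma eq_circles_st G f f' :
  {in edges G, f =1 f'} -> circles (@st f G) = circles (@st f' G).
Proof. by move=> ff'; apply: eq_circles => x; rewrite /st ff' // imset_f. Qed.

Section StReroute.
Variables (G : ribbon L) (j : flag G -> flag G) (jK : involutive j).
Hypothesis j_seg : forall x, (j (seg x) == seg x) = (j x == x).
Hypothesis j_side : forall x, (j (side x) == side x) = (j x == x).

Lemma val_st_reroute f (x : flag (reroute jK j_seg j_side)) :
  val (st f x) = st f (val x).
Proof. by rewrite /st /move; case: (nat_of_ord (f _)) => [|[|]]. Qed.

Lemma reroute_st f (s : flag G -> flag G) :
  (forall x, j x = x -> s x = st f x) -> (forall x, j x != x -> s x = j x) ->
  circles (@st f (reroute jK j_seg j_side)) = circles s.
Proof.
move=> fixed moved; apply: (@reroute_circles _ _ _ jK s _ _ _ moved).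
  exact: (@stK _ (reroute jK j_seg j_side)).
by move=> x; rewrite val_st_reroute fixed //; apply/eqP/(valP x).
Qed.

Lemma edges_reroute : edges (reroute jK j_seg j_side) = [set lab x | x : flag G & j x == x].
Proof.
apply/setP => l; apply/imsetP/imsetP => -[x xP ->].
  by exists (val x) => //; rewrite inE (valP x).
by move: xP; rewrite inE => jx; exists (exist _ x jx).
Qed.
End StReroute.

(** The boundary of the resolved graph is a circle count whose pairing is [side] of that graph: on
    twisted edges the Petrial has turned it into [seg] after [side], and the deleted edges are
    exactly those rerouted along [seg]. *)
Lemma nb_boundary_st G (M N : {set L}) f :
  {in edges G, forall l, (l \in M) = (f l == 1%N :> nat)} ->
  {in edges G, forall l, (l \in N) = (f l == 2%N :> nat)} ->
  nb_boundary (delete (petrial G N) M) = circles (@st f G).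
Proof.
move=> fM fN; pose D := delete (petrial G N) M.
apply: (@reroute_circles _ (petrial G N) _ _ (@st f G) (@side _ D) (@sideK _ D)).
- case=> x /= xM; rewrite /st /petrial_side fN ?imset_f //.
  move: xM; rewrite /on_edges fM ?imset_f // /move.
  case: (f _) => [[|[|[|]]] //= _].
  by rewrite (negPf (seg_neq _)).
- move=> x; rewrite /on_edges; case: ifP => [xM _|]; last by rewrite eqxx.
  by move: xM; rewrite fM ?imset_f // /st /move => /eqP ->.
Qed.

Definition upd f (a : L) q : L -> 'I_3 := fun l => if l == a then q else f l.

Lemma delete_st G a f q : q = 1%N :> nat ->
  circles (@st f (delete G [set a])) = circles (@st (upd f a q) G).
Proof.
move=> q1; apply: reroute_st => x; rewrite /on_edges /st /upd /= inE.
  by case: (lab x == a) => // /eqP; rewrite (negPf (seg_neq _)).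
by case: (lab x == a); rewrite ?eqxx // /move q1.
Qed.

Lemma contract_st G a f q : q = 0%N :> nat ->
  circles (@st f (contract G a)) = circles (@st (upd f a q) G).
Proof.
move=> q0; apply: reroute_st => x; rewrite /on_edges /st /upd /= inE.
  by case: (lab x == a) => // /eqP; rewrite (negPf (side_neq _)).
by case: (lab x == a); rewrite ?eqxx // /move q0.
Qed.

(** Contraction runs along the sides of the edge, and after the half-twist these are the crossed
    ones, [move] 2. Together with the two preceding lemmas, this identifies the left sides of the
    linear system with the three resolutions of [a]. *)
Lemma contract_petrial_st G a f q : q = 2%N :> nat ->
  circles (@st f (contract (petrial G [set a]) a)) = circles (@st (upd f a q) G).
Proof.
move=> q2.
apply: (@reroute_st (petrial G [set a]) _ _ _ _ _ (@st (upd f a q) G)) => x;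
  rewrite /on_edges /st /upd /= inE.
  case: (eqVneq (lab x) a) => [_ jx|xa _].
    by case/eqP: (@side_neq _ (petrial G [set a]) x).
  by rewrite /move /= /petrial_side inE (negPf xa).
case: (eqVneq (lab x) a) => [xa _|]; last by rewrite eqxx.
by rewrite /move q2 /= /petrial_side inE xa eqxx.
Qed.

Lemma edges_delete1 G a : edges (delete G [set a]) = edges G :\ a.
Proof.
rewrite /delete edges_reroute; apply/setP => l; rewrite !inE.
apply/imsetP/andP => [[x]|[la /imsetP[x _ def_l]]].
  rewrite inE /on_edges inE => + ->; case: (eqVneq (lab x) a) => [_|xa _]; last by rewrite imset_f.
  by rewrite (negPf (seg_neq _)).
by exists x => //; rewrite inE /on_edges inE -def_l (negPf la).
Qed.

Lemma edges_contract G a : edges (contract G a) = edges G :\ a.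
Proof.
rewrite /contract edges_reroute; apply/setP => l; rewrite !inE.
apply/imsetP/andP => [[x]|[la /imsetP[x _ def_l]]].
  rewrite inE /on_edges inE => + ->; case: (eqVneq (lab x) a) => [_|xa _]; last by rewrite imset_f.
  by rewrite (negPf (side_neq _)).
by exists x => //; rewrite inE /on_edges inE -def_l (negPf la).
Qed.

End States.
Arguments st {L} f {G} x.
Arguments stK {L} f {G} x.

(** * The pairing of the corners of an open edge *)

Section Pairing.
Variables (L : finType) (H : ribbon L) (y : flag H).
Hypothesis edge_y : forall w : flag H, lab w = lab y -> w \in edge_flags y.
Variable f : L -> 'I_3.

(** Leaving the corners of the edge of [y] fixed, rather than pairing them, makes them the only
    flags kept when rerouting along [open_st]. *)
Definition open_st (w : flag H) : flag H := if lab w == lab y then w else st f w.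

Lemma open_stK : involutive open_st.
Proof.
move=> w; rewrite /open_st; case: (boolP (lab w == lab y)) => wy; first by rewrite wy.
by rewrite /st !lab_move (negPf wy) moveK.
Qed.

Lemma open_st_fix w : (open_st w == w) = (w \in edge_flags y).
Proof.
rewrite /open_st; case: (eqVneq (lab w) (lab y)) => wy.
  by rewrite eqxx edge_y.
rewrite (negPf (move_neq _ _)); apply/esym/negP => /edge_flags_lab.
by apply/eqP.
Qed.

Definition open_rel : rel (flag H) := circ_rel (@varc _ H) open_st.

(** The value of [reroute_free] for [open_st]: the free vertices and the curves that miss all four
    corners. *)
Definition loose : nat :=
  (nb_free H + n_comp open_rel
     [pred x | [forall z, connect open_rel x z ==> (open_st z != z)]])%N.

Lemma open_sym : connect_sym open_rel.
Proof. exact: circ_sym (@arcK _ H) open_stK. Qed.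

Let y0 : kept open_st := exist _ y (etrans (open_st_fix y) (edge_flags_refl y)).
Let arc := reroute_arc open_stK.

Let kept_edge (u : kept open_st) : val u \in edge_flags y.
Proof. by rewrite -open_st_fix; apply: (valP u). Qed.

Let other (u v : kept open_st) : v != u -> exists q, val v = move q (val u).
Proof.
move=> uv; have := edge_flags_trans (kept_edge u) (kept_edge v).
by case/edge_flagsP => // /val_inj eq_uv; rewrite eq_uv eqxx in uv.
Qed.

(** [arc] is an involution without fixed points on four corners. If it takes [y] to [move p y], it
    must exchange the other two corners, and by the Klein group law these also differ by
    [move p]. *)
Lemma arc_move : exists p, forall u, val (arc u) = move p (val u).
Proof.
have [p def_p] := other (reroute_arc_neq open_stK y0); exists p => u.
case: (eqVneq u y0) => [-> //|/other[q def_u]].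
case: (eqVneq q p) => [eq_qp|neq_qp].
  suff -> : u = arc y0 by rewrite [arc _]reroute_arcK [in RHS]def_p moveK.
  by apply: val_inj; rewrite def_u def_p eq_qp.
have [r def_r] := other (reroute_arc_neq open_stK u).
have fin (x : kept open_st) : val (arc u) = val x -> u = arc x.
  by move=> /val_inj <-; rewrite [RHS]reroute_arcK.
case: (eqVneq r p) => [<- //|neq_rp]; exfalso.
case: (eqVneq r q) => [eq_rq|neq_rq].
  have : u = arc y0 by apply: fin; rewrite [LHS]def_r def_u eq_rq moveK.
  move/(congr1 val); rewrite def_u [RHS]def_p => /move_inj_label eq_qp.
  by rewrite eq_qp eqxx in neq_qp.
have : u = arc (arc y0).
  apply: fin; rewrite [RHS]def_p [LHS]def_r def_u.
  exact: move_third.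
rewrite [RHS]reroute_arcK => /(congr1 val); rewrite def_u => /eqP.
by rewrite (negPf (move_neq _ _)).
Qed.

(** Rerouting along [open_st] leaves one edge with four corners, joined by [p] along the arcs and by
    [q] in the resolution. This makes two circles if the two pairings coincide and one if not, next
    to the [loose] curves. *)
Lemma open_stP : exists p,
  (forall u w, u \in edge_flags y -> w \in edge_flags y ->
     connect open_rel u w = (w == u) || (w == move p u)) /\
  (forall q, circles (@st _ (upd f (lab y) q) H) = (loose + 1 + (p == q))%N).
Proof.
have [p arcE] := arc_move; exists p; split=> [u w|q].
  rewrite -(open_st_fix u) -(open_st_fix w) => ju jw.
  pose u' : kept open_st := exist _ u ju; pose w' : kept open_st := exist _ w jw.
  have := @reroute_connect _ _ _ open_stK open_st id
    (fun x => esym (eqP (valP x))) (fun _ _ => erefl) u' w'.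
  rewrite -/open_rel => <-.
  have def_w : (w == u) || (w == move p u) = (w' == u') || (w' == arc u').
    by rewrite -!val_eqE [val (arc _)]arcE.
  rewrite def_w; apply/idP/idP => [|/orP[] /eqP ->].
  - apply: (connect_ind (P := fun z => (z == u') || (z == arc u'))); last by rewrite eqxx.
    move=> z z' zP /orP[] /eqP -> //.
    case/orP: zP => /eqP -> /=; first by rewrite eqxx orbT.
    by rewrite [reroute_arc _ _]reroute_arcK eqxx.
  - exact: connect0.
  - by apply: connect1; rewrite /= eqxx orbT.
have j_seg x : (open_st (seg x) == seg x) = (open_st x == x).
  by rewrite !open_st_fix edge_flags_seg.
have j_side x : (open_st (side x) == side x) = (open_st x == x).
  by rewrite !open_st_fix edge_flags_side.
pose K := reroute open_stK j_seg j_side.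
have -> : circles (@st _ (upd f (lab y) q) H) = circles (@st _ (upd f (lab y) q) K).
  apply/esym/reroute_st => x; rewrite /open_st /st /upd //.
  by case: (lab x == lab y); rewrite ?eqxx.
rewrite /circles -addnA addnC /loose; congr (_ + _)%N.
have stE (u : flag K) : val (st (upd f (lab y) q) u) = move q (val u).
  rewrite val_st_reroute /st /upd (edge_flags_lab (kept_edge u)).
  by rewrite eqxx.
have stK' : involutive (@st _ (upd f (lab y) q) K) := stK (upd f (lab y) q).
have symK := circ_sym (@arcK _ K) stK'.
set e := circ_rel _ _ in symK *.
have c_arc u : connect e u (arc u) by apply: connect1; rewrite /e /= eqxx orbT.
have c_st u : connect e u (st (upd f (lab y) q) u) by apply: connect1; rewrite /e /= eqxx.
(* [move r y] represents the arc that does not contain [y], so every circle passes through [y] or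
   [move r y]. When [q] differs from [p], taking [r] equal to [q] makes the resolution itself join
   the two. *)
have [r neq_rp eq_rq] : exists2 r, r != p & (p == q) || (r == q).
  case: (eqVneq p q) => [<-|]; last by exists q; rewrite // ?eqxx // eq_sym.
  case: (boolP (p == ord0)) => p0; last by exists ord0; rewrite // eq_sym.
  by exists ord_max => //; rewrite (eqP p0).
have z0P : open_st (move r y) == move r y.
  by rewrite open_st_fix edge_flags_move edge_flags_refl.
pose z0 : kept open_st := exist _ (move r y) z0P.
have -> : n_comp e predT = n_comp e (closure e (pred2 (y0 : flag K) z0)).
  apply: eq_n_comp_r => u; apply/esym/existsP => /=.
  suff : [|| u == y0, u == arc y0, u == z0 | u == arc z0].
    case/or4P => /eqP ->; [exists y0 | exists y0 | exists z0 | exists z0];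
      rewrite !inE /= ?eqxx ?orbT ?andbT ?connect0 //; rewrite symK; exact: c_arc.
  rewrite -!val_eqE ![val (arc _)]arcE /=.
  case/edge_flagsP: (kept_edge u) => [->|[s ->]]; first by rewrite eqxx.
  case: (eqVneq s r) => [->|neq_sr]; first by rewrite eqxx !orbT.
  case: (eqVneq s p) => [->|neq_sp]; first by rewrite eqxx !orbT.
  by rewrite (@move_third _ _ p r s) ?eqxx ?orbT // eq_sym.
rewrite (n_comp_closure2 symK); case: (eqVneq p q) => [def_q|neq_pq]; last first.
  rewrite (_ : connect e _ _) //.
  have -> : z0 = st (upd f (lab y) q) (y0 : flag K).
    by apply: val_inj; rewrite stE /=; case/orP: eq_rq neq_pq => /eqP ->; rewrite ?eqxx.
  exact: c_st.
rewrite (_ : connect e _ _ = false) //; apply/negP => c.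
have : ((z0 : flag K) == y0) || ((z0 : flag K) == arc y0).
  apply: (connect_ind (P := fun z => (z == y0) || (z == arc y0))) c; last by rewrite eqxx.
  move=> z z' zP /orP[] /eqP ->.
    rewrite -!val_eqE stE [val (arc _)]arcE -def_q.
    case/orP: zP => /eqP ->; first by rewrite eqxx orbT.
    by rewrite [val (arc _)]arcE moveK eqxx.
  case/orP: zP => /eqP ->; first by rewrite [varc _]/(arc _) eqxx orbT.
  by rewrite [varc _]reroute_arcK eqxx.
rewrite -!val_eqE [val (arc _)]arcE /= (negPf (move_neq _ _)) /= => /eqP.
by move/move_inj_label => eq_rp; rewrite eq_rp eqxx in neq_rp.
Qed.

Definition nb_resolved q : nat := circles (@st _ (upd f (lab y) q) H).

(** If the rest of [H] joins the corners of the edge as [p] does and has [c] closed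
curves, then the three resolutions of the edge give [c + 2] circles for [p] and
[c + 1] for the other two; [c] and [p] are read off these numbers, which makes
their invariance under isomorphism immediate. *)
Definition inner : nat := (minn (nb_resolved (inord 0)) (nb_resolved (inord 1))).-1.

Definition pairing : 'I_3 :=
  if (nb_resolved (inord 1) < nb_resolved (inord 0))%N then inord 0
  else if (nb_resolved (inord 0) < nb_resolved (inord 1))%N then inord 1
  else inord 2.

(** At most one of the resolutions 0 and 1 is [p], so the smaller of their counts is [c + 1]; if the
    two counts agree, [p] can only be 2. *)
Lemma inner_pairing c p :
  (forall q, nb_resolved q = (c + 1 + (p == q))%N) -> inner = c /\ pairing = p.
Proof.
move=> resE; have ordE (i : nat) : (i < 3)%N -> (p == inord i) = (nat_of_ord p == i).
  by move=> lt_i; rewrite -val_eqE /= inordK.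
rewrite /inner /pairing !resE !ordE //.
case: p {resE ordE} => [[|[|[|]]] //= lt]; (split; first lia);
  repeat (case: ifP => ?; try (exfalso; lia)); apply: val_inj; by rewrite /= inordK.
Qed.

Lemma nb_resolvedE q : nb_resolved q = (inner + 1 + (pairing == q))%N.
Proof.
by have [p [_ resE]] := open_stP; have [-> ->] := inner_pairing resE; apply: resE.
Qed.

Lemma inner_loose : inner = loose.
Proof. by have [p [_ resE]] := open_stP; have [-> _] := inner_pairing resE. Qed.

Lemma pairing_connect u w : u \in edge_flags y -> w \in edge_flags y ->
  connect open_rel u w = (w == u) || (w == move pairing u).
Proof.
have [p [conn resE]] := open_stP; have [_ ->] := inner_pairing resE.
exact: conn.
Qed.

End Pairing.

(** * Two-sums and tensor products *)

Section TwoSumCircles.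
Variables (L : finType) (G H : ribbon L) (x : flag G) (y : flag H).
Hypothesis edge_x : forall z : flag G, lab z = lab x -> z \in edge_flags x.
Hypothesis edge_y : forall w : flag H, lab w = lab y -> w \in edge_flags y.
Variable f : L -> 'I_3.

Let join := two_sum_join x y.

(** Joining tails to heads sends [x] to [seg y] and extends this equivariantly for the Klein group
    of moves. Commutation with [move q] is what carries a pairing of corners from [H] over to
    [G]. *)
Lemma two_sum_join_move z : z \in edge_flags x ->
  exists2 w, w \in edge_flags y & join (inl z) = inr w /\
    forall q, join (inl (move q z)) = inr (move q w).
Proof.
have [xs xd xsd [sd]] : [/\ (seg x == x) = false, (side x == x) = false,
    (side (seg x) == x) = false & (side x == seg x) = false /\
     ((side (seg x) == seg x) = false /\ (side x == side (seg x)) = false)].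
  have := edge_flags_uniq x; rewrite /edge_flags /= !inE !negb_or andbT seg_side.
  case/and3P=> /and3P[/negPf h1 /negPf h2 /negPf h3] /andP[/negPf h4 /negPf h5] /negPf h6.
  by do !split; rewrite // eq_sym.
move=> [ssd dsd].
have j0 : join (inl x) = inr (seg y) by rewrite /join /= eqxx.
have j1 : join (inl (seg x)) = inr y by rewrite /join /= xs eqxx.
have j2 : join (inl (side x)) = inr (side (seg y)).
  by rewrite /join /= xd sd dsd eqxx.
have j3 : join (inl (side (seg x))) = inr (side y).
  by rewrite /join /= xsd ssd eqxx.
have norm := (seg_side, segK, sideK, j0, j1, j2, j3).
have in_y i : nth y (edge_flags y) i \in edge_flags y.
  case: (ltnP i 4) => [lt_i|le_i]; first exact: (@mem_nth _ y (edge_flags y)).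
  by rewrite nth_default // edge_flags_refl.
rewrite !inE => /or4P[] /eqP ->.
- exists (seg y); first exact: (in_y 1%N).
  by split=> // q; elim/ord3P: q => *; rewrite /move /= !norm.
- exists y; first exact: (in_y 0%N).
  by split=> // q; elim/ord3P: q => *; rewrite /move /= !norm.
- exists (side (seg y)); first by have := in_y 3%N; rewrite /= seg_side.
  by split=> // q; elim/ord3P: q => *; rewrite /move /= !norm.
- exists (side y); first exact: (in_y 2%N).
  by rewrite !norm; split=> // q; elim/ord3P: q => *; rewrite /move /= !norm.
Qed.

Lemma two_sum_join_inr w : w \in edge_flags y ->
  exists2 z, z \in edge_flags x & join (inl z) = inr w.
Proof.
move=> wy; have [w0 w0y [j0 jm]] := two_sum_join_move (edge_flags_refl x).
case/edge_flagsP: (edge_flags_trans w0y wy) => [->|[q ->]].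
  by exists x; rewrite ?edge_flags_refl.
by exists (move q x); rewrite ?edge_flags_move ?edge_flags_refl.
Qed.

Let U := disjoint_union G H.
Let s (z : flag U) : flag U := if join z == z then st f z else join z.
Let e := circ_rel (@varc _ U) s.
Let p := pairing y f.
Let e1 := circ_rel (@varc _ G) (st (upd f (lab x) p)).

Let s_fixed z : join z = z -> s z = st f z.
Proof. by rewrite /s => ->; rewrite eqxx. Qed.

Let s_moved z : join z != z -> s z = join z.
Proof. by rewrite /s => /negPf ->. Qed.

Let sK : involutive s.
Proof.
have stK' := stK f (G := two_sum x y).
apply: (@reroute_invol _ _ _ (two_sum_joinK x y) _ _ stK' _ s_moved) => z.
by rewrite val_st_reroute s_fixed //; apply/eqP/(valP z).
Qed.

Let s_inl z : s (inl z) = if z \in edge_flags x then join (inl z) else inl (st f z).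
Proof.
rewrite /s two_sum_join_fix; case: (z \in edge_flags x) => //=.
by rewrite /st /move; case: (nat_of_ord (f _)) => [|[|]].
Qed.

Let s_inr w : s (inr w) = if w \in edge_flags y then join (inr w) else inr (st f w).
Proof.
rewrite /s two_sum_join_fix; case: (w \in edge_flags y) => //=.
by rewrite /st /move; case: (nat_of_ord (f _)) => [|[|]].
Qed.

Let openE w : open_st y f w = if w \in edge_flags y then w else st f w.
Proof.
rewrite -(open_st_fix edge_y f); case: eqP => // /eqP.
by rewrite /open_st; case: (lab w == lab y); rewrite ?eqxx.
Qed.

Let e1_st z : st (upd f (lab x) p) z = if z \in edge_flags x then move p z else st f z.
Proof.
rewrite /st /upd; case: (boolP (z \in edge_flags x)) => [/edge_flags_lab ->|xz].
  by rewrite eqxx.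
by case: eqP => // /edge_x; rewrite (negPf xz).
Qed.

Let conn_inr w w' : connect (open_rel y f) w w' -> connect e (inr w) (inr w').
Proof.
apply: connect_map => z z' /orP[] /eqP ->; last first.
  by apply: connect1; rewrite /e /= eqxx orbT.
rewrite openE; case: ifP => zy; first exact: connect0.
by apply: connect1; rewrite /e /= s_inr zy eqxx.
Qed.

Let pairing_conn u w : u \in edge_flags y -> w \in edge_flags y ->
  connect (open_rel y f) u w = (w == u) || (w == move p u).
Proof. exact: pairing_connect. Qed.

Let join_inr z w : join (inl z) = inr w -> join (inr w) = inl z.
Proof. by move=> <-; apply: two_sum_joinK. Qed.

(** A resolution step of [G] at a corner [z] of the edge of [x] becomes an excursion: enter [H] at
    the joined corner [w], follow the arc of [H] to [move p w], and come back at [move p z]. *)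
Let conn_inl z z' : connect e1 z z' = connect e (inl z) (inl z').
Proof.
apply/idP/idP.
  apply: connect_map => {}z {}z' /orP[] /eqP ->; last first.
    by apply: connect1; rewrite /e /= eqxx orbT.
  rewrite e1_st; case: ifP => xz; last by apply: connect1; rewrite /e /= s_inl xz eqxx.
  have [w wy [jz jm]] := two_sum_join_move xz.
  apply: (@connect_trans _ _ (inr w)).
    by apply: connect1; rewrite /e /= s_inl xz jz eqxx.
  apply: (@connect_trans _ _ (inr (move p w))).
    by apply: conn_inr; rewrite pairing_conn ?edge_flags_move // eqxx orbT.
  apply: connect1; rewrite /e /= s_inr edge_flags_move wy.
  by rewrite (join_inr (jm p)) eqxx.
(* While the walk is inside [H], the invariant remembers the corner through which it entered; the
   walk can leave only there or at the partner under [move p]. *)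
pose P (v : flag U) : Prop := match v return Prop with
  | inl z' => connect e1 z z'
  | inr w => exists u z0, [/\ connect e1 z z0, z0 \in edge_flags x,
      u \in edge_flags y, join (inl z0) = inr u & connect (open_rel y f) u w]
  end.
move=> c; suff: P (inl z') by [].
apply: connect_ind c; last exact: connect0.
move=> [{}z'|w] v.
  move=> /= c /orP[] /eqP ->; last first.
    by apply: connect_trans c (connect1 _); rewrite /e1 /= eqxx orbT.
  rewrite s_inl; case: ifP => xz.
    have [w wy [jz _]] := two_sum_join_move xz; rewrite jz.
    by exists w, z'; split=> //; apply: connect0.
  by apply: connect_trans c (connect1 _); rewrite /e1 /= e1_st xz eqxx.
case=> u [z0 [c xz0 uy jz0 cu]] /orP[] /eqP ->; last first.
  by exists u, z0; split=> //; apply: connect_trans cu (connect1 _);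
    rewrite /open_rel /= eqxx orbT.
rewrite s_inr; case: ifP => wy; last first.
  exists u, z0; split=> //; apply: connect_trans cu (connect1 _).
  by rewrite /open_rel /= openE wy eqxx.
have [u' _ [jz0' jm]] := two_sum_join_move xz0.
have eq_u : u' = u by move: jz0'; rewrite jz0 => -[].
rewrite eq_u in jm; move: cu; rewrite pairing_conn // => /orP[] /eqP ->.
  by rewrite (join_inr jz0).
rewrite (join_inr (jm p)); apply: connect_trans c (connect1 _).
by rewrite /e1 /= e1_st xz0 eqxx.
Qed.

Let sealed := [pred w | [forall z, connect (open_rel y f) w z ==> (open_st y f z != z)]].

Let sealed_conn w v : w \in sealed -> connect e (inr w) v ->
  exists2 w', v = inr w' & connect (open_rel y f) w w'.
Proof.
move=> /forallP w_sealed.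
apply: (connect_ind (P := fun v => exists2 w', v = inr w' & connect (open_rel y f) w w')).
  move=> _ v' [w' -> c] /orP[] /eqP ->; last first.
    exists (varc w') => //; apply: connect_trans c (connect1 _).
    by rewrite /open_rel /= eqxx orbT.
  have := implyP (w_sealed w') c; rewrite open_st_fix // => wy.
  rewrite s_inr (negPf wy); exists (st f w') => //.
  apply: connect_trans c (connect1 _).
  by rewrite /open_rel /= openE (negPf wy) eqxx.
by exists w => //; apply: connect0.
Qed.

(** The closed curves that reach [G] are those of [G] with the edge of [x] resolved by the pairing
    of [H]; all others are sealed inside [H] and, with its free vertices, make up [inner]. *)
Lemma two_sum_circles :
  circles (@st _ f (two_sum x y)) =
  (inner y f + circles (@st _ (upd f (lab x) (pairing y f)) G))%N.
Proof.
rewrite (@reroute_st _ _ _ _ _ _ f s s_fixed s_moved) /circles -/e.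
rewrite (inner_loose edge_y) /loose -/p -/e1 -/sealed.
rewrite (n_comp_split (h1 := inl) (h2 := inr) (e1 := e1) (e2 := open_rel y f)
  (a2 := sealed)) /=; first 1 last.
- exact: circ_sym (@arcK _ U) sK.
- exact: circ_sym (@arcK _ G) (stK _).
- exact: open_sym.
- exact: conn_inl.
- by case=> z; [left | right]; exists z; apply: connect0.
- move=> w; apply/idP/idP => [w_sealed|].
    by apply/existsPn => z; apply/negP => /(sealed_conn w_sealed)[].
  apply: contraR; rewrite inE negb_forall => /existsP[w'].
  rewrite negb_imply negbK open_st_fix // => /andP[c wy].
  have [z _ jz] := two_sum_join_inr wy.
  apply/existsP; exists z; apply: connect_trans (conn_inr c) (connect1 _).
  by rewrite /e /= s_inr wy (join_inr jz) eqxx.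
- move=> w w' w_sealed; apply/idP/idP; first exact: conn_inr.
  by move=> /(sealed_conn w_sealed)[w'' [->]].
by rewrite addnACA [RHS]addnC; congr (_ + _)%N; rewrite addnC.
Qed.

End TwoSumCircles.

Lemma edges_two_sum (L : finType) (G H : ribbon L) (x : flag G) (y : flag H) :
  (forall z : flag G, lab z = lab x -> z \in edge_flags x) ->
  (forall w : flag H, lab w = lab y -> w \in edge_flags y) ->
  edges (two_sum x y) = (edges G :\ lab x) :|: (edges H :\ lab y).
Proof.
move=> edge_x edge_y; rewrite /two_sum edges_reroute; apply/setP => l.
have xE (z : flag G) : (z \in edge_flags x) = (lab z == lab x).
  by apply/idP/eqP; [apply: edge_flags_lab | apply: edge_x].
have yE (z : flag H) : (z \in edge_flags y) = (lab z == lab y).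
  by apply/idP/eqP; [apply: edge_flags_lab | apply: edge_y].
apply/imsetP/setUP => [[[z|w]]|].
- rewrite inE two_sum_join_fix xE => zx ->; left.
  by rewrite !inE /= zx imset_f.
- rewrite inE two_sum_join_fix yE => wy ->; right.
  by rewrite !inE /= wy imset_f.
case=> /setD1P[nl /imsetP[z _ def_l]].
  by exists (inl z); rewrite // inE two_sum_join_fix xE -def_l.
by exists (inr z); rewrite // inE two_sum_join_fix yE -def_l.
Qed.

Lemma eq_nb_resolved (L : finType) (H : ribbon L) (y : flag H) (f f' : L -> 'I_3) :
  {in edges H :\ lab y, f =1 f'} -> nb_resolved y f =1 nb_resolved y f'.
Proof.
move=> ff' q; apply: eq_circles_st => l lH; rewrite /upd.
by case: (eqVneq l (lab y)) => // ly; apply: ff'; rewrite !inE ly.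
Qed.

Lemma eq_inner (L : finType) (H : ribbon L) (y : flag H) (f f' : L -> 'I_3) :
  {in edges H :\ lab y, f =1 f'} -> inner y f = inner y f'.
Proof. by move=> ff'; rewrite /inner !(eq_nb_resolved ff'). Qed.

Lemma eq_pairing (L : finType) (H : ribbon L) (y : flag H) (f f' : L -> 'I_3) :
  {in edges H :\ lab y, f =1 f'} -> pairing y f = pairing y f'.
Proof. by move=> ff'; rewrite /pairing !(eq_nb_resolved ff'). Qed.

Section TensorCircles.
Variables (L : finType) (G : ribbon L) (Hs : L -> ribbon L).
Variable o : forall e, flag (Hs e).
Hypothesis edge_o : forall e, e \in edges G ->
  forall w : flag (Hs e), lab w = e -> w \in edge_flags (o e).
Hypothesis lab_o : forall e, e \in edges G -> lab (o e) = e.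
Hypothesis common_edge : forall e, e \in edges G -> edges G :&: edges (Hs e) = [set e].

(** The induction runs over an arbitrary intermediate graph [K]; its invariant is that each edge
    still to be replaced survives in [K] and shares its name with no other edge. This persists
    because [Hs e] meets the edges of [G] only in [e], so a new copy never brings in a pending
    name. *)
Lemma tensor_recP (f : L -> 'I_3) (s : seq (flag G)) (K : ribbon L)
    (emb : flag G -> option (flag K)) :
  uniq [seq lab x | x <- s] ->
  (forall x, x \in s -> exists x', [/\ emb x = Some x', lab x' = lab x &
     forall z : flag K, lab z = lab x -> z \in edge_flags x']) ->
  circles (@st _ f (tensor_rec o emb s)) =
    (\sum_(e <- [seq lab x | x <- s]) inner (o e) f +
     circles (@st _ (fun l => if l \in [seq lab x | x <- s] then pairing (o l) f
                              else f l) K))%N /\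
  edges (tensor_rec o emb s) =
    (edges K :\: [set l in [seq lab x | x <- s]]) :|:
    \bigcup_(e <- [seq lab x | x <- s]) (edges (Hs e) :\ e).
Proof.
elim: s K emb => [|x s IHs] K emb /=.
  move=> _ _; rewrite !big_nil add0n setU0; split; first exact: eq_circles_st.
  by apply/setP => l; rewrite !inE.
case/andP=> xs s_uniq emb_s.
have [x' [-> lab_x' edge_x']] := emb_s x (mem_head _ _).
have Gx : lab x \in edges G by rewrite imset_f.
have s_edges l : l \in [seq lab x | x <- s] -> l \in edges G.
  by case/mapP=> z _ ->; rewrite imset_f.
set K1 := two_sum x' (o (lab x)); set emb1 := fun z => _.
have lab_ox := lab_o Gx.
have edge_x (z : flag K) : lab z = lab x' -> z \in edge_flags x'.
  by rewrite lab_x'; apply: edge_x'.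
have edge_ox (w : flag (Hs (lab x))) :
    lab w = lab (o (lab x)) -> w \in edge_flags (o (lab x)).
  by rewrite lab_ox; apply: edge_o.
have disj l : l \in [seq lab x | x <- s] -> l \in edges (Hs (lab x)) -> False.
  move=> ls lH; have : l \in edges G :&: edges (Hs (lab x)).
    by rewrite inE s_edges.
  by rewrite common_edge // inE => /eqP eq_l; rewrite -eq_l ls in xs.
have [] := IHs K1 emb1 s_uniq.
  move=> x2 x2s; have [|x2' [emb_x2 lab_x2' edge_x2']] := emb_s x2.
    by rewrite inE x2s orbT.
  have lx2 : lab x2 \in [seq lab x | x <- s] by apply: map_f.
  have x2K : two_sum_join x' (o (lab x)) (inl x2') == inl x2'.
    rewrite two_sum_join_fix; apply/negP => /edge_flags_lab.
    by rewrite lab_x' lab_x2' => eq_l; rewrite -eq_l lx2 in xs.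
  exists (exist _ (inl x2') x2K : flag K1); split=> //.
    rewrite /emb1 emb_x2 /= /two_sum_inl; case: insubP => [u _ val_u|].
      by congr Some; apply: val_inj.
    by rewrite x2K.
  case=> -[z|w] zK /= lab_z; last first.
    by case: (disj _ lx2); rewrite -lab_z imset_f.
  by have := edge_x2' z lab_z; rewrite !inE -!val_eqE.
move=> -> ->; split; last first.
  rewrite edges_two_sum // lab_ox lab_x' big_cons; apply/setP => l; rewrite !inE.
  case: (boolP (l \in [seq lab x | x <- s])) => ls /=; last first.
    by rewrite orbF; case: (l == lab x); rewrite ?orbA.
  rewrite orbT /=; case: (boolP (l \in edges (Hs (lab x)))) => [/(disj _ ls)//|_].
  by rewrite andbF.
rewrite two_sum_circles // ?lab_x' //.
(* The state that the induction hypothesis puts on the two-sum: pending edges carry their pairings.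
   It agrees with [f] on the copy just glued, whose edges are not pending. *)
pose f' l := if l \in [seq lab x | x <- s] then pairing (o l) f else f l.
rewrite -/f'.
have ff' : {in edges (Hs (lab x)) :\ lab (o (lab x)), f' =1 f}.
  move=> l /setD1P[_ lH]; rewrite /f'; case: ifP => // ls.
  by case: (disj _ ls lH).
rewrite (eq_inner ff') (eq_pairing ff') big_cons addnCA addnA; congr (_ + _)%N.
apply: eq_circles_st => l _; rewrite /upd inE /f'.
by case: eqP => [->|].
Qed.

Lemma tensorP (f : L -> 'I_3) (s : seq (flag G)) :
  proper_labels G -> perm_eq [seq lab x | x <- s] (enum (edges G)) ->
  circles (@st _ f (tensor o s)) =
    (\sum_(e in edges G) inner (o e) f +
     circles (@st _ (fun l => pairing (o l) f) G))%N /\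
  edges (tensor o s) = \bigcup_(e in edges G) (edges (Hs e) :\ e).
Proof.
move=> proper_G s_edges.
have mem_s l : (l \in [seq lab x | x <- s]) = (l \in edges G).
  by rewrite (perm_mem s_edges) mem_enum.
have [] := @tensor_recP f s G (@Some _).
- by rewrite (perm_uniq s_edges) enum_uniq.
- by move=> x xs; exists x; split=> // z lab_z; apply: proper_G.
rewrite -/(tensor o s) => -> ->.
rewrite !(perm_big _ s_edges) /= !big_enum /=; split.
  by congr (_ + _)%N; apply: eq_circles_st => l lG; rewrite mem_s lG.
apply/setP => l; rewrite in_setU; case: (boolP (l \in _ :\: _)) => //.
by rewrite !inE mem_s andNb.
Qed.

End TensorCircles.

(** * Lower bound by connected components, and invariance under isomorphism *)

Lemma n_comp_sub (T : finType) (e e' : rel T) :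
  connect_sym e -> connect_sym e' -> (forall x y, e' x y -> connect e x y) ->
  (n_comp e predT <= n_comp e' predT)%N.
Proof.
move=> sym sym' sub; rewrite /n_comp_mem.
have sub_c x y : connect e' x y -> connect e x y by apply: (connect_map (h := id)).
rewrite -(card_in_image (f := fingraph.root e')).
  apply: subset_leq_card; apply/subsetP => _ /imageP[x _ ->].
  by rewrite !inE roots_root.
move=> x y; rewrite !inE !andbT => /eqP rx /eqP ry eq_r.
rewrite -rx -ry; apply/(fingraph.rootP sym); apply: sub_c.
by apply/(fingraph.rootP sym').
Qed.

Lemma graph_sym (L : finType) (G : ribbon L) : connect_sym (@graph_rel _ G).
Proof.
apply: sym_connect_sym => x y; rewrite /graph_rel /= !(eq_sym y).
by rewrite (can2_eq (@segK _ G) (@segK _ G)) (can2_eq (@sideK _ G) (@sideK _ G))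
  (can2_eq (@arcK _ G) (@arcK _ G)).
Qed.

Lemma nb_comp_circles (L : finType) (G : ribbon L) (f : L -> 'I_3) :
  (nb_comp G <= circles (@st _ f G))%N.
Proof.
rewrite /nb_comp /circles leq_add2r; apply: n_comp_sub => [||x y].
- exact: graph_sym.
- exact: circ_sym (@arcK _ G) (stK f (G := G)).
case/orP=> /eqP ->; last by apply: connect1; rewrite /graph_rel /= eqxx !orbT.
rewrite /st /move; case: (nat_of_ord _) => [|[|_]].
- by apply: connect1; rewrite /graph_rel /= eqxx orbT.
- by apply: connect1; rewrite /graph_rel /= eqxx.
apply: (@connect_trans _ _ (side x)); apply: connect1; rewrite /graph_rel /= eqxx //.
by rewrite orbT.
Qed.

Section IsoCircles.
Variables (L : finType) (H1 H2 : ribbon L) (phi : flag H1 -> flag H2).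
Hypothesis phi_iso : is_iso phi.

Lemma iso_circles (f1 f2 : L -> 'I_3) :
  (forall x, f1 (lab x) = f2 (lab (phi x))) ->
  circles (@st _ f1 H1) = circles (@st _ f2 H2).
Proof.
case: phi_iso => -[psi phiK psiK] phi_seg phi_side phi_arc phi_free f12.
rewrite /circles phi_free; congr (_ + _)%N; apply/esym.
have phi_st x : phi (st f1 x) = st f2 (phi x).
  rewrite /st f12 /move; case: (nat_of_ord _) => [|[|_]] //.
  by rewrite phi_seg phi_side.
have sym1 := circ_sym (@arcK _ H1) (stK f1 (G := H1)).
have sym2 := circ_sym (@arcK _ H2) (stK f2 (G := H2)).
rewrite (adjunction_n_comp phi sym2 sym1) //.
split=> [x _|x y _]; first by exists (psi x); rewrite psiK connect0.
apply/idP/idP.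
  apply: connect_map => z z' /orP[] /eqP ->; apply: connect1; rewrite /=.
    by rewrite phi_st eqxx.
  by rewrite phi_arc eqxx orbT.
rewrite -{2}(phiK x) -{2}(phiK y).
apply: connect_map => z z' /orP[] /eqP ->; apply: connect1; rewrite /=.
  by rewrite (can2_eq psiK phiK) phi_st psiK eqxx.
by rewrite !(can2_eq psiK phiK) phi_arc !psiK eqxx orbT.
Qed.

Hypotheses (proper1 : proper_labels H1) (proper2 : proper_labels H2).

(** Isomorphisms may rename edges, but equality of names means belonging to the same edge, which
    [seg] and [side] determine. *)
Lemma iso_lab x y : (lab (phi x) == lab (phi y)) = (lab x == lab y).
Proof.
case: phi_iso => phi_bij phi_seg phi_side _ _.
have memE (K : ribbon L) (Kp : proper_labels K) (z w : flag K) :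
    (lab z == lab w) = (w \in edge_flags z).
  by apply/eqP/idP => [/Kp //|/edge_flags_lab].
rewrite !memE // !inE -?(phi_seg, phi_side) !(inj_eq (bij_inj phi_bij)).
by [].
Qed.

Variable y : flag H1.
Variables f1 f2 : L -> 'I_3.
Hypothesis f12 : forall x, lab x != lab y -> f1 (lab x) = f2 (lab (phi x)).

Lemma iso_nb_resolved : nb_resolved y f1 =1 nb_resolved (phi y) f2.
Proof.
move=> q; apply: iso_circles => x; rewrite /upd iso_lab.
by case: eqVneq => // /f12.
Qed.

Lemma iso_inner : inner y f1 = inner (phi y) f2.
Proof. by rewrite /inner !iso_nb_resolved. Qed.

Lemma iso_pairing : pairing y f1 = pairing (phi y) f2.
Proof. by rewrite /pairing !iso_nb_resolved. Qed.

End IsoCircles.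

(** * State sums *)

Section StateSums.
Variables (L : finType) (R : comNzRingType).
Implicit Types (E : {set L}) (f : {ffun L -> 'I_3}) (W : L -> 'I_3 -> R) (t : R).

(** States are normalised to be [ord0] off the edges under consideration. *)
Definition states E : {set {ffun L -> 'I_3}} :=
  [set f : {ffun L -> 'I_3} | [forall l, (l \notin E) ==> (f l == ord0)]].

Definition restrict E (f : L -> 'I_3) : {ffun L -> 'I_3} :=
  [ffun l => if l \in E then f l else ord0].

Lemma statesP E f : reflect (forall l, l \notin E -> f l = ord0) (f \in states E).
Proof.
rewrite inE; apply: (iffP forallP) => f0 l; last by apply/implyP => /f0 ->.
by move/(implyP (f0 l))/eqP.
Qed.

Lemma restrict_states E (f : L -> 'I_3) : restrict E f \in states E.
Proof. by apply/statesP => l lE; rewrite ffunE (negPf lE). Qed.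

Lemma restrict_id E f : (restrict E f == f) = (f \in states E).
Proof.
apply/eqP/idP => [<-|/statesP f0]; first exact: restrict_states.
by apply/ffunP => l; rewrite ffunE; case: ifPn => // /f0.
Qed.

Definition weight (u v w : L -> R) (l : L) (q : 'I_3) : R :=
  match nat_of_ord q with 0 => u l | 1 => v l | _ => w l end.

Lemma weight_inord (F : L -> 'I_3 -> R) :
  weight (F^~ (inord 0)) (F^~ (inord 1)) (F^~ (inord 2)) =2 F.
Proof.
move=> l q; rewrite /weight.
by case: q => [[|[|[|]]] //= lt]; congr (F _ _); apply: val_inj; rewrite /= inordK.
Qed.

Lemma Q_states (G : ribbon L) (u v w : L -> R) t :
  Q G u v w t = \sum_(f in states (edges G))
    (\prod_(l in edges G) weight u v w l (f l)) * t ^+ circles (@st _ f G).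
Proof.
set E := edges G.
pose cell f i := [set l in E | f l == i :> nat].
pose h f : {set L} * {set L} * {set L} := (cell f 0%N, cell f 1%N, cell f 2%N).
(* [ord0] serves both the first block and the names outside [E], in accordance with the
   normalisation of [states]. *)
pose h' (P : {set L} * {set L} * {set L}) : {ffun L -> 'I_3} :=
  [ffun l => if l \in P.1.2 then inord 1 else if l \in P.2 then inord 2 else ord0].
have hh' P : ordered_partition E P -> h (h' P) = P.
  case: P => [[A M] N] /and4P[/eqP defE dAM dAN dMN].
  have sub l : [|| l \in A, l \in M | l \in N] = (l \in E).
    by rewrite -defE !inE orbA.
  congr (_, _, _); apply/setP => l; rewrite inE ffunE /= -sub;
    have := disjointFr dAM (x := l); have := disjointFr dAN (x := l);
    have := disjointFr dMN (x := l);
    case: (l \in A); case: (l \in M); case: (l \in N) => //= h1 h2 h3;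
    rewrite ?inordK //; first [by have := h1 isT | by have := h2 isT | by have := h3 isT].
rewrite /Q (reindex_onto h h' hh').
apply: eq_big => [f|f _].
  have -> : ordered_partition E (h f).
    apply/and4P; split; first last.
    - by rewrite disjoint_subset; apply/subsetP => l; rewrite !inE => /andP[-> /eqP ->].
    - by rewrite disjoint_subset; apply/subsetP => l; rewrite !inE => /andP[-> /eqP ->].
    - by rewrite disjoint_subset; apply/subsetP => l; rewrite !inE => /andP[-> /eqP ->].
    apply/eqP/setP => l; rewrite !inE.
    by case: (l \in E) => //; case: (f l) => [[|[|[|]]]].
  rewrite -restrict_id; congr (_ == _); apply/ffunP => l; rewrite !ffunE !inE /=.
  case: (l \in E) => //=; case: (f l) => [[|[|[|]]] //= i]; apply: val_inj;
  by rewrite /= ?inordK.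
rewrite /h (nb_boundary_st (f := f)); try by move=> l lE; rewrite inE lE.
congr (_ * _); rewrite !(big_mkcond (fun l => l \in _)) -!big_split /=.
apply: eq_bigr => l _; rewrite !inE /weight; case: (l \in E); last by rewrite !mulr1.
by case: (f l) => [[|[|[|]]] //= _]; rewrite ?mulr1 ?mul1r.
Qed.

Section Merge.
Variables (E : L -> {set L}) (c : L -> {ffun L -> 'I_3} -> nat).
Variables (p : L -> {ffun L -> 'I_3} -> 'I_3).
Hypothesis disjE : forall e e', e != e' -> [disjoint E e & E e'].

(** A state on the disjoint union is a family of states on the blocks. Sorting the families by the
    pairings [q] they induce fixes the factor [g q], and distributivity turns the remaining sum of
    products into a product of sums. *)
Lemma sum_merge W t (g : {ffun L -> 'I_3} -> R) :
  \sum_(f in states (\bigcup_e E e))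
     (\prod_(l in \bigcup_e E e) W l (f l)) *
     (\prod_e t ^+ c e (restrict (E e) f)) *
     g [ffun e => p e (restrict (E e) f)] =
  \sum_q g q *
     \prod_e \sum_(h in states (E e) | p e h == q e)
       (\prod_(l in E e) W l (h l)) * t ^+ c e h.
Proof.
pose F e (h : {ffun L -> 'I_3}) := (\prod_(l in E e) W l (h l)) * t ^+ c e h.
transitivity (\sum_(ff in family (fun e => states (E e)))
    g [ffun e => p e (ff e)] * \prod_e F e (ff e)); last first.
  rewrite (partition_big (fun ff : {ffun L -> {ffun L -> 'I_3}} =>
    [ffun e => p e (ff e)]) predT) //=.
  apply: eq_bigr => q _; rewrite (bigA_distr_big_dep
    (fun e h => (h \in states (E e)) && (p e h == q e)) F) big_distrr /=.
  apply: eq_big => [ff|ff /andP[_ /eqP -> //]].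
  apply/andP/familyP => [[/familyP ffE /eqP <-] e|ffE].
    by apply/andP; split; [exact: ffE | rewrite ffunE].
  split; first by apply/familyP => e; have /andP[] := ffE e.
  apply/eqP/ffunP => e; rewrite ffunE.
  by have /andP[_ /eqP] := ffE e.
pose h f : {ffun L -> {ffun L -> 'I_3}} := [ffun e => restrict (E e) f].
pose h' (ff : {ffun L -> {ffun L -> 'I_3}}) : {ffun L -> 'I_3} :=
  [ffun l => if [pick e | l \in E e] is Some e then ff e l else ord0].
have pickE e l : l \in E e -> [pick e | l \in E e] = Some e.
  case: pickP => [e' le' le|->//]; congr Some; apply/eqP/negP => /negP ne.
  by have := disjointFr (disjE ne) le'; rewrite le.
rewrite [RHS](reindex_onto h h'); last first.
  move=> ff /familyP ffE; apply/ffunP => e; rewrite ffunE; apply/ffunP => l.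
  rewrite !ffunE; case: ifPn => [/pickE -> //|le].
  by move/statesP: (ffE e) => ->.
apply: eq_big => [f|f _].
  have -> : h f \in family (fun e => states (E e)).
    by apply/familyP => e; rewrite ffunE restrict_states.
  rewrite -restrict_id; congr (_ == _); apply/ffunP => l; rewrite !ffunE.
  case: pickP => [e le|nE].
    by rewrite !ffunE le; case: bigcupP => // -[]; exists e.
  by case: bigcupP => // -[e _]; rewrite nE.
rewrite mulrC; congr (_ * _).
  by congr g; apply/ffunP => e; rewrite !ffunE.
rewrite /F big_split partition_disjoint_bigcup //=; congr (_ * _).
  by apply: eq_bigr => e _; apply: eq_bigr => l le; rewrite !ffunE le.
by apply: eq_bigr => e _; rewrite ffunE.
Qed.
End Merge.

(** The sum over the states of [H] minus the edge of [y] that join the corners of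
that edge as [q] does; [m] common closed curves are left out. *)
Definition tangle (H : ribbon L) (y : flag H) W t (m : nat) (q : 'I_3) : R :=
  \sum_(f in states (edges H :\ lab y) | pairing y f == q)
    (\prod_(l in edges H :\ lab y) W l (f l)) * t ^+ (inner y f - m).

(** Resolving the edge differently from its pairing gives [inner + 1] circles, and every component
    of [H] carries at least one. Hence subtracting k(H) - 1 from the exponents in [tangle] never
    truncates. *)
Lemma inner_ge (H : ribbon L) (y : flag H) (f : L -> 'I_3) :
  proper_labels H -> (nb_comp H - 1 <= inner y f)%N.
Proof.
move=> proper_H; pose q : 'I_3 := if pairing y f == ord0 then ord_max else ord0.
have := nb_comp_circles H (upd f (lab y) q).
have -> : circles (@st _ (upd f (lab y) q) H) = nb_resolved y f q by [].
rewrite nb_resolvedE => [|w lab_w]; last exact: proper_H.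
have -> : (pairing y f == q) = false.
  rewrite /q; case: (boolP (pairing y f == ord0)) => [/eqP -> //|].
  by move/negPf.
by lia.
Qed.

Lemma nb_comp_gt0 (H : ribbon L) (y : flag H) : (0 < nb_comp H)%N.
Proof.
rewrite /nb_comp addn_gt0; apply/orP; left; apply/card_gt0P.
by exists (fingraph.root (@graph_rel _ H) y); rewrite !inE (roots_root (@graph_sym _ H)).
Qed.

Lemma tangle_system (H : ribbon L) (y : flag H) W t q : proper_labels H ->
  \sum_(f in states (edges H :\ lab y))
    (\prod_(l in edges H :\ lab y) W l (f l)) * t ^+ nb_resolved y f q =
  t ^+ nb_comp H * \sum_r t ^+ (r == q) * tangle y W t (nb_comp H - 1) r.
Proof.
move=> proper_H; rewrite big_distrr /=.
rewrite (partition_big (fun f : {ffun L -> 'I_3} => pairing y f) predT) //=.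
apply: eq_bigr => r _; rewrite /tangle !big_distrr /=.
apply: eq_bigr => f /andP[_ /eqP def_r].
rewrite nb_resolvedE => [|w lab_w]; last exact: proper_H.
rewrite [X in _ = _ * X]mulrCA [RHS]mulrCA; congr (_ * _).
rewrite -!exprD def_r; congr (_ ^+ _).
(* Exponents: inner + 1 = k + (inner - (k - 1)), which needs k > 0 and inner at least k - 1. *)
have := inner_ge y f proper_H; have := nb_comp_gt0 y.
by move: (nb_comp H) (inner y f) (nat_of_bool _) => k c b; lia.
Qed.

End StateSums.

(** * Polynomials and the linear system *)

Section Relabel.
Variable L : finType.
Implicit Types (s : L -> L) (A : {set L}).

Definition var_weight (l : L) (q : 'I_3) : polyZ L := indet (Some (l, q)).

Lemma weight_var : weight (@varU L) (@varV L) (@varW L) =2 var_weight.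
Proof. exact: weight_inord. Qed.

Lemma relabel_indet s i : relabel s (indet i) = indet (relabel_var s i).
Proof. by rewrite /relabel /indet comp_mpolyXU -tnth_nth tnth_mktuple enum_rankK. Qed.

Lemma relabel_sum s (I : finType) (P : pred I) (F : I -> polyZ L) :
  relabel s (\sum_(i | P i) F i) = \sum_(i | P i) relabel s (F i).
Proof. exact: rmorph_sum. Qed.

Lemma relabel_prod s (I : finType) (P : pred I) (F : I -> polyZ L) :
  relabel s (\prod_(i | P i) F i) = \prod_(i | P i) relabel s (F i).
Proof. exact: rmorph_prod. Qed.

Lemma relabelM s p q : relabel s (p * q) = relabel s p * relabel s q.
Proof. exact: rmorphM. Qed.

Lemma relabelX s p n : relabel s (p ^+ n) = relabel s p ^+ n.
Proof. exact: rmorphXn. Qed.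

Lemma in_vars0 A : in_vars A 0.
Proof. by move=> m e i; rewrite -[0]/(0%:MP) msupp0. Qed.

Lemma in_vars1 A : in_vars A 1.
Proof. by move=> m e i; rewrite -[1]/(1%:MP) msupp1 inE => /eqP ->; rewrite mnm0E. Qed.

Lemma in_varsD A p q : in_vars A p -> in_vars A q -> in_vars A (p + q).
Proof.
move=> pA qA m e i /msuppD_le; rewrite mem_cat => /orP[mp|mq]; first exact: pA.
exact: qA.
Qed.

Lemma in_varsM A p q : in_vars A p -> in_vars A q -> in_vars A (p * q).
Proof.
move=> pA qA m e i /msuppM_le /allpairsP[[m1 m2] /= [m1p m2q ->]].
rewrite mnmDE addn_eq0 negb_and => /orP[]; first exact: pA.
exact: qA.
Qed.

Lemma in_varsX A p n : in_vars A p -> in_vars A (p ^+ n).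
Proof.
move=> pA; elim: n => [|n IHn]; first exact: in_vars1.
by rewrite exprS; apply: in_varsM.
Qed.

Lemma in_vars_indet A i : (if i is Some ei then ei.1 \in A else true) ->
  in_vars A (indet i).
Proof.
move=> iA m e j; rewrite /indet msuppX inE => /eqP ->; rewrite mnm1E.
by rewrite eqb0 negbK => /eqP/enum_rank_inj def_i; rewrite def_i in iA.
Qed.

Lemma in_vars_tangle (H : ribbon L) (y : flag H) m q :
  in_vars (edges H :\ lab y) (tangle y var_weight (varT L) m q).
Proof.
apply: big_ind; [exact: in_vars0 | exact: in_varsD |] => f _.
apply: in_varsM; last by apply: in_varsX; apply: in_vars_indet.
apply: big_ind; [exact: in_vars1 | exact: in_varsM |] => l lA.
exact: in_vars_indet.
Qed.

Section Transport.
Variables (H1 H2 : ribbon L) (phi : flag H1 -> flag H2).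
Hypothesis phi_iso : is_iso phi.
Hypotheses (proper1 : proper_labels H1) (proper2 : proper_labels H2).
Variable y : flag H1.

Let inv := edge_inv phi.
Let fwd (l : L) : L := if [pick x | lab x == l] is Some x then lab (phi x) else l.

Lemma edge_invE x : edge_inv phi (lab (phi x)) = lab x.
Proof.
rewrite /edge_inv; case: pickP => [x'|/(_ x)]; last by rewrite eqxx.
by rewrite iso_lab // => /eqP.
Qed.

Let fwdE x : fwd (lab x) = lab (phi x).
Proof.
rewrite /fwd; case: pickP => [x'|/(_ x)]; last by rewrite eqxx.
by rewrite -(iso_lab phi_iso) // => /eqP.
Qed.

Let E1 := edges H1 :\ lab y.
Let E2 := edges H2 :\ lab (phi y).

Let E2P l : reflect (exists2 x, lab x != lab y & l = lab (phi x)) (l \in E2).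
Proof.
apply: (iffP setD1P) => [[ly /imsetP[z _ def_l]]|[x xy ->]]; last first.
  by rewrite iso_lab // imset_f.
case: phi_iso => -[psi phiK psiK] _ _ _ _; exists (psi z); rewrite ?psiK //.
by rewrite -(iso_lab phi_iso) // psiK -def_l.
Qed.

Let E1P l : reflect (exists2 x : flag H1, lab x != lab y & l = lab x) (l \in E1).
Proof.
apply: (iffP setD1P) => [[ly /imsetP[z _ def_l]]|[x xy ->]]; last by rewrite imset_f.
by exists z; rewrite -?def_l.
Qed.

Let E1E : E1 = inv @: E2.
Proof.
apply/setP => l; apply/E1P/imsetP => [[x xy ->]|[_ /E2P[x xy ->] ->]].
  by exists (lab (phi x)); rewrite /inv ?edge_invE //; apply/E2P; exists x.
by exists x; rewrite // /inv edge_invE.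
Qed.

Let inv_inj : {in E2 &, injective inv}.
Proof.
move=> _ _ /E2P[x _ ->] /E2P[x' _ ->]; rewrite /inv !edge_invE => eq_xx'.
by apply/eqP; rewrite iso_lab // eq_xx'.
Qed.

(** [phi] matches the states of the two graphs together with their pairings and closed curves. The
    left side counts all closed curves, the right side leaves out [m] of them, whence the factor. *)
Lemma relabel_tangle m q :
  (forall f : {ffun L -> 'I_3}, m <= inner (phi y) f)%N ->
  tangle y var_weight (varT L) 0 q =
  varT L ^+ m * relabel (edge_inv phi) (tangle (phi y) var_weight (varT L) m q).
Proof.
move=> le_m; rewrite /tangle -/E1 -/E2 relabel_sum big_distrr /=.
(* [A] pulls a state of [H2] back along [phi] and [B] pushes a state of [H1] forward; normalisation
   off the edges makes them mutually inverse. *)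
pose A (f : {ffun L -> 'I_3}) := restrict E1 (fun l => f (fwd l)).
pose B (h : {ffun L -> 'I_3}) := restrict E2 (fun l => h (inv l)).
have AE (f : {ffun L -> 'I_3}) x : lab x != lab y -> A f (lab x) = f (lab (phi x)).
  move=> xy; rewrite ffunE (_ : lab x \in E1) ?fwdE //.
  by apply/E1P; exists x.
rewrite (reindex_onto A B) => [|h /andP[/statesP h0 _]]; last first.
  apply/ffunP => l; case: (boolP (l \in E1)) => [/E1P[x xy ->]|lE].
    rewrite AE // ffunE (_ : lab (phi x) \in E2); last by apply/E2P; exists x.
    by rewrite /inv edge_invE.
  by rewrite ffunE (negPf lE) h0.
apply: eq_big => [f|f _].
  rewrite restrict_states (iso_pairing phi_iso proper1 proper2 (AE f)) andbC.
  congr (_ && _); rewrite -restrict_id; congr (_ == _); apply/ffunP => l.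
  rewrite [LHS]ffunE [RHS]ffunE; case: ifP => // /E2P[x xy ->].
  by rewrite /inv edge_invE AE.
rewrite (iso_inner phi_iso proper1 proper2 (AE f)) subn0.
rewrite relabelM relabel_prod relabelX relabel_indet -/(varT L) mulrCA -exprD subnKC //.
congr (_ * _); rewrite E1E (big_imset _ inv_inj) /=; apply: eq_bigr => _ /E2P[x xy ->].
by rewrite /var_weight relabel_indet /= /inv edge_invE AE.
Qed.

End Transport.

Lemma varT_neq0 : varT L != 0.
Proof.
apply/eqP => /(congr1 (meval (fun=> 1%:Z))); rewrite /varT /indet mevalXU.
by rewrite (raddf0 (meval _)).
Qed.

Lemma varT_sub1_neq0 : varT L - 1 != 0.
Proof.
apply/eqP => /(congr1 (meval (fun=> 0%:Z))); rewrite mevalB /varT /indet mevalXU.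
by rewrite (raddf0 (meval _)) meval1.
Qed.

Lemma varT_add2_neq0 : varT L + 2%:R != 0.
Proof.
apply/eqP => /(congr1 (meval (fun=> 0%:Z))); rewrite mevalD /varT /indet mevalXU.
by rewrite (raddf0 (meval _)) mevalMn meval1.
Qed.

End Relabel.

(** With d = y - z, subtracting two equations leaves (t - 1)(d_i - d_j) = 0, so all d_i are equal,
    and the first equation becomes (t + 2) d_0 = 0. *)
Lemma circulant_inj (R : idomainType) (t y0 y1 y2 z0 z1 z2 : R) :
  t - 1 != 0 -> t + 2%:R != 0 ->
  t * y0 + y1 + y2 = t * z0 + z1 + z2 -> y0 + t * y1 + y2 = z0 + t * z1 + z2 ->
  y0 + y1 + t * y2 = z0 + z1 + t * z2 ->
  (y0, y1, y2) = (z0, z1, z2).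
Proof.
move=> t1 t2 e0 e1 e2.
have eq_diff d d' : (t - 1) * (d - d') = 0 -> d = d'.
  by move/eqP; rewrite mulf_eq0 (negPf t1) subr_eq0 => /eqP.
have d01 : y0 - z0 = y1 - z1.
  apply: eq_diff; rewrite (_ : _ * _ = t * y0 + y1 + y2 - (t * z0 + z1 + z2) -
    (y0 + t * y1 + y2 - (z0 + t * z1 + z2))); last by ring.
  by rewrite e0 e1 !subrr.
have d02 : y0 - z0 = y2 - z2.
  apply: eq_diff; rewrite (_ : _ * _ = t * y0 + y1 + y2 - (t * z0 + z1 + z2) -
    (y0 + y1 + t * y2 - (z0 + z1 + t * z2))); last by ring.
  by rewrite e0 e2 !subrr.
have /eqP : (t + 2%:R) * (y0 - z0) = 0.
  rewrite (_ : _ * _ = t * y0 + y1 + y2 - (t * z0 + z1 + z2) +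
    (y0 - z0 - (y1 - z1)) + (y0 - z0 - (y2 - z2))); last by ring.
  by rewrite e0 -d01 -d02 !subrr !addr0.
rewrite mulf_eq0 (negPf t2) subr_eq0 => /eqP y0z0.
move: d01 d02; rewrite y0z0 subrr => /esym/eqP; rewrite subr_eq0 => /eqP ->.
by move=> /esym/eqP; rewrite subr_eq0 => /eqP ->.
Qed.

Section System.
Variables (L : finType) (H : ribbon L) (y : flag H).
Hypothesis proper_H : proper_labels H.

Let Y q : polyZ L := tangle y (@var_weight L) (varT L) (nb_comp H - 1) q.

Let Qvar (K : ribbon L) := Q K (@varU L) (@varV L) (@varW L) (varT L).

Lemma Q_tangle (K : ribbon L) q : edges K = edges H :\ lab y ->
  (forall f : L -> 'I_3, circles (@st _ f K) = nb_resolved y f q) ->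
  Qvar K = varT L ^+ nb_comp H * \sum_r varT L ^+ (r == q) * Y r.
Proof.
move=> edges_K circles_K; rewrite -tangle_system // /Qvar Q_states edges_K.
apply: eq_bigr => f _; rewrite circles_K; congr (_ * _).
by apply: eq_bigr => l _; apply: weight_var.
Qed.

Lemma sum_ord3 (R : nmodType) (F : 'I_3 -> R) :
  \sum_r F r = F (inord 0) + F (inord 1) + F (inord 2).
Proof.
rewrite !big_ord_recr big_ord0 /= add0r.
by congr (F _ + F _ + F _); apply: val_inj; rewrite /= inordK.
Qed.

(** Resolution [q] closes one additional circle exactly for the states with pairing [q]: this puts t
    on the diagonal of the system and 1 elsewhere. *)
Lemma tensor_system_tangle :
  tensor_system H (lab y) (Y (inord 0), Y (inord 1), Y (inord 2)).
Proof.
have ordE i j : (i < 3)%N -> (j < 3)%N -> ((inord i : 'I_3) == inord j) = (i == j).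
  by move=> lt_i lt_j; rewrite -val_eqE /= !inordK.
split.
- rewrite -/(Qvar _) (@Q_tangle _ (inord 0)) ?edges_contract // => [|f].
    by rewrite sum_ord3 !ordE // expr1 expr0 !mul1r.
  by apply: contract_st; rewrite inordK.
- rewrite -/(Qvar _) (@Q_tangle _ (inord 1)) ?edges_delete1 // => [|f].
    by rewrite sum_ord3 !ordE // expr1 expr0 !mul1r.
  by apply: delete_st; rewrite inordK.
rewrite -/(Qvar _) (@Q_tangle _ (inord 2)) ?edges_contract // => [|f].
  by rewrite sum_ord3 !ordE // expr1 expr0 !mul1r.
by apply: contract_petrial_st; rewrite inordK.
Qed.

End System.

Lemma tensor_system_inj (L : finType) (H : ribbon L) (a : L)
    (z z' : polyZ L * polyZ L * polyZ L) :
  tensor_system H a z -> tensor_system H a z' -> z = z'.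
Proof.
case: z z' => [[z0 z1] z2] [[z0' z1'] z2'] [e0 e1 e2] [e0' e1' e2'].
(* Cancellation takes place in the polynomial ring seen as an integral domain, while [polyZ] records
   only a commutative ring. *)
have tk_neq0 : (varT L : {mpoly int[#|var L|]}) ^+ nb_comp H != 0.
  by rewrite expf_neq0 // varT_neq0.
have cancel_t (p q : {mpoly int[#|var L|]}) :
    (varT L : {mpoly int[#|var L|]}) ^+ nb_comp H * p = varT L ^+ nb_comp H * q -> p = q.
  exact: mulfI.
apply: (@circulant_inj {mpoly int[#|var L|]} (varT L)).
- exact: varT_sub1_neq0.
- exact: varT_add2_neq0.
- by apply: cancel_t; rewrite -[LHS]e0.
- by apply: cancel_t; rewrite -[LHS]e1.
- by apply: cancel_t; rewrite -[LHS]e2.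
Qed.

(** * The polynomial of the tensor product *)

Section TensorSum.
Variables (L : finType) (R : comNzRingType) (G : ribbon L) (Hs : L -> ribbon L).
Variables (o : forall e, flag (Hs e)) (oG : seq (flag G)).
Hypothesis proper_G : proper_labels G.
Hypothesis oG_edges : perm_eq [seq lab x | x <- oG] (enum (edges G)).
Hypothesis HsP : forall e, e \in edges G ->
  [/\ proper_labels (Hs e), edges G :&: edges (Hs e) = [set e] & lab (o e) = e].
Hypothesis disjHs : forall e f, e \in edges G -> f \in edges G -> e != f ->
  [disjoint edges (Hs e) & edges (Hs f)].

Lemma Q_tensor (u v w : L -> R) (t : R) :
  Q (tensor o oG) u v w t =
  \sum_(q in states (edges G))
    (\prod_(e in edges G) tangle (o e) (weight u v w) t 0 (q e)) *
    t ^+ circles (@st _ q G).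
Proof.
set EG := edges G.
have lab_o e : e \in EG -> lab (o e) = e by case/HsP.
have edge_o e : e \in EG -> forall x : flag (Hs e), lab x = e -> x \in edge_flags (o e).
  by move=> /HsP[proper_e _ lab_e] x lab_x; apply: proper_e; rewrite lab_e.
have common e : e \in EG -> EG :&: edges (Hs e) = [set e] by case/HsP.
have tenP f := tensorP edge_o lab_o common f proper_G oG_edges.
(* Names outside [G] get an empty block, count 0 and pairing [ord0]: they then contribute a factor 1
   if [q] is normalised there and 0 otherwise, which cuts the sum over all [q] down to the states of
   [G]. *)
pose E e := if e \in EG then edges (Hs e) :\ e else set0.
pose c e (f : {ffun L -> 'I_3}) := if e \in EG then inner (o e) f else 0%N.
pose p e (f : {ffun L -> 'I_3}) := if e \in EG then pairing (o e) f else ord0.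
pose g (q : {ffun L -> 'I_3}) := t ^+ circles (@st _ q G).
have disjE e e' : e != e' -> [disjoint E e & E e'].
  move=> ne; rewrite /E; case: ifP => eG; last by rewrite -setI_eq0 set0I.
  case: ifP => e'G; last by rewrite -setI_eq0 setI0.
  apply: disjointWl (subsetDl _ _) _; apply: disjointWr (subsetDl _ _) _.
  exact: disjHs.
have tensor_edges : edges (tensor o oG) = \bigcup_e E e.
  by rewrite (proj2 (tenP (fun=> ord0))) big_mkcond.
have restrictE (f : {ffun L -> 'I_3}) e : e \in EG ->
    {in edges (Hs e) :\ lab (o e), f =1 restrict (E e) f}.
  by move=> eG l; rewrite lab_o // ffunE /E eG => ->.
rewrite Q_states tensor_edges.
transitivity (\sum_(f in states (\bigcup_e E e))
     (\prod_(l in \bigcup_e E e) weight u v w l (f l)) *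
     (\prod_e t ^+ c e (restrict (E e) f)) *
     g [ffun e => p e (restrict (E e) f)]).
  apply: eq_bigr => f _; rewrite (proj1 (tenP f)) exprD mulrA; congr (_ * _ * _).
    rewrite big_mkcond -prodrXr; apply: eq_bigr => e _; rewrite /c.
    by case: ifP => // eG; rewrite (eq_inner (restrictE f e eG)).
  congr (_ ^+ _); apply: eq_circles_st => e eG; rewrite ffunE /p ifT //.
  exact: eq_pairing (restrictE f e eG).
rewrite sum_merge // (bigID (mem (states EG))) /= [X in _ + X]big1 ?addr0.
  apply: eq_bigr => q /statesP q0; rewrite mulrC; congr (_ * _).
  rewrite [RHS]big_mkcond; apply: eq_bigr => e _; rewrite /c /p /E.
  case: ifPn => eG.
    by rewrite /tangle lab_o //; apply: eq_bigr => f _; rewrite subn0.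
  rewrite (big_pred1 [ffun=> ord0]) ?big_set0 ?mulr1 // => h.
  rewrite q0 // eqxx andbT; apply/statesP/eqP => [h0|-> l _]; last by rewrite ffunE.
  by apply/ffunP => l; rewrite ffunE h0 ?inE.
move=> q; rewrite inE negb_forall => /existsP[e].
rewrite negb_imply => /andP[eG qe]; rewrite (bigD1 e) //= big_pred0 ?mul0r ?mulr0 //.
by move=> h; rewrite /p (negPf eG) eq_sym (negPf qe) andbF.
Qed.
End TensorSum.

Theorem theorem36 (L : finType) (G : ribbon L) (oG : seq (flag G))
    (Hs : L -> ribbon L) (o : forall e : L, flag (Hs e))
    (H : ribbon L) (a : L) (oH : flag H)
    (phi : forall e : L, flag (Hs e) -> flag H) :
  (* G, with a local orientation and a direction of each edge *)
  proper_labels G ->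
  (forall e, e \in edges G -> ~ bridge G e /\ ~ trivial_loop G e) ->
  perm_eq [seq lab x | x <- oG] (enum (edges G)) ->
  (* the family H_e *)
  (forall e, e \in edges G ->
    [/\ proper_labels (Hs e), edges G :&: edges (Hs e) = [set e] & lab (o e) = e]) ->
  (forall e f, e \in edges G -> f \in edges G -> e != f ->
    [disjoint edges (Hs e) & edges (Hs f)]) ->
  (* H and its distinguished edge a *)
  proper_labels H -> lab oH = a -> ~ bridge H a -> ~ trivial_loop H a ->
  (* the isomorphisms phi_e *)
  (forall e, e \in edges G -> is_iso (phi e) /\ phi e (o e) = oH) ->
  exists y : polyZ L * polyZ L * polyZ L,
    unique
      (fun z => [/\ in_vars (edges H :\ a) z.1.1, in_vars (edges H :\ a) z.1.2,
                    in_vars (edges H :\ a) z.2 & tensor_system H a z]) y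
    /\ Q (tensor o oG) (@varU L) (@varV L) (@varW L) (varT L) =
       varT L ^+ (#|edges G| * (nb_comp H - 1))%N *
       Q G (fun e => relabel (edge_inv (phi e)) y.1.1)
           (fun e => relabel (edge_inv (phi e)) y.1.2)
           (fun e => relabel (edge_inv (phi e)) y.2) (varT L).
Proof.
move=> proper_G _ oG_edges HsP disjHs proper_H <- _ _ phiP.
pose m := (nb_comp H - 1)%N.
pose Y q := tangle oH (@var_weight L) (varT L) m q.
exists (Y (inord 0), Y (inord 1), Y (inord 2)); split.
  split; last by move=> z [_ _ _]; apply: tensor_system_inj; apply: tensor_system_tangle.
  by split; [| | | exact: tensor_system_tangle]; apply: in_vars_tangle.
rewrite (Q_tensor proper_G oG_edges HsP disjHs) Q_states big_distrr /=.
apply: eq_bigr => q _; rewrite mulrA; congr (_ * _).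
(* The power of t is distributed as one factor [t ^+ m] per edge of [G]: it restores the closed
   curves left out of the tangle of [H] for the copy at that edge. *)
rewrite mulnC exprM -prodr_const -big_split /=; apply: eq_bigr => e eG.
have [proper_e _ lab_e] := HsP e eG; have [phi_iso phi_o] := phiP e eG.
transitivity (tangle (o e) (@var_weight L) (varT L) 0 (q e)).
  apply: eq_bigr => f _; congr (_ * _).
  by apply: eq_bigr => l _; apply: weight_var.
rewrite (relabel_tangle phi_iso proper_e proper_H (m := m)) => [|f]; last first.
  exact: inner_ge.
congr (_ * _); rewrite phi_o -[tangle _ _ _ _ _]/(Y (q e)).
exact/esym/(weight_inord (fun e r => relabel (edge_inv (phi e)) (Y r))).
Qed.
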